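(* For all complex $x$ and $y$ such that neither $x^2$ nor $y^2$ is a negative integer, $$\begin{aligned} \sum_{n=1}^\infty\left(\frac{n}{n^2+y^2}+\sum_{m=1}^{n-1}\frac{2m}{m^2+y^2}\right)\frac{1}{n^2+x^2} &=(x^2-4y^2)\,\pi x\coth(\pi x)\sum_{n=1}^\infty\frac{n}{(n^2+y^2)\left\{(n^2-x^2+y^2)^2+(2nx)^2\right\}}\\ &\quad+\bigl(2\pi y\coth(\pi y)+\pi x\coth(\pi x)\bigr)\sum_{n=1}^\infty\frac{n}{(n^2-x^2+y^2)^2+(2nx)^2}, \end{aligned}$$ where the right-hand side is understood as its limiting value (continuous extension) at those points $(x,y)$ where it has a removable singularity, namely where $x=0$ or $y=0$ (with $\pi z\coth(\pi z)$ taken to be $1$ at $z=0$) or where some denominator $(n^2-x^2+y^2)^2+(2nx)^2$ with $n\ge 1$ vanishes.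
   Context: The inner sum over $m$ is empty (equal to $0$) when $n=1$. One has $(n^2-x^2+y^2)^2+(2nx)^2=\left((n+ix)^2+y^2\right)\left((n-ix)^2+y^2\right)$, which vanishes for some integer $n\ge 1$ exactly when $x+y$ or $x-y$ is a nonzero integer multiple of $i$. *)

(* Defs.v *)
(* Stdlib real numbers with Coquelicot's complex numbers *)
From Stdlib Require Export Reals.
From Coquelicot Require Export Coquelicot.
Open Scope C_scope.

Definition Cexp (z : C) : C :=
  RtoC (exp (Re z)) * (cos (Im z), sin (Im z)).

Definition Ccosh (z : C) : C := (Cexp z + Cexp (- z)) / 2.
Definition Csinh (z : C) : C := (Cexp z - Cexp (- z)) / 2.
Definition Ccoth (z : C) : C := Ccosh z / Csinh z.

(* pi z coth (pi z), with its limiting value 1 at z = 0 *)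
Definition pi_coth (z : C) : C :=
  if Ceq_dec z 0 then 1 else PI * z * Ccoth (PI * z).

(* All series below start at n = 1. *)
Definition ex_Cseries1 (u : nat -> C) : Prop :=
  ex_series (V := C_NormedModule) (fun k => u (S k)).

(* Meaningful only when [ex_Cseries1 u] holds, like [Series] and [RInt]. *)
Definition Cseries1 (u : nat -> C) : C :=
  iota (T := C_CompleteNormedModule)
    (is_series (V := C_NormedModule) (fun k => u (S k))).

Definition negative_integer (z : C) : Prop :=
  exists k : Z, (k < 0)%Z /\ z = IZR k.

Definition admissible (x y : C) : Prop :=
  ~ negative_integer (x ^ 2) /\ ~ negative_integer (y ^ 2).

(* [sum_n_m a 1 (n - 1)] is the empty sum for n = 1. *)
Definition lhs_term (x y : C) (n : nat) : C :=
  (INR n / (INR n ^ 2 + y ^ 2)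
   + sum_n_m (G := C_AbelianMonoid)
       (fun m => 2 * INR m / (INR m ^ 2 + y ^ 2)) 1 (n - 1))
  * (1 / (INR n ^ 2 + x ^ 2)).

Definition lhs (x y : C) : C := Cseries1 (lhs_term x y).

Definition den (x y : C) (n : nat) : C :=
  (INR n ^ 2 - x ^ 2 + y ^ 2) ^ 2 + (2 * INR n * x) ^ 2.

Definition rhs_term1 (x y : C) (n : nat) : C :=
  INR n / ((INR n ^ 2 + y ^ 2) * den x y n).

Definition rhs_term2 (x y : C) (n : nat) : C := INR n / den x y n.

Definition rhs (x y : C) : C :=
  (x ^ 2 - 4 * y ^ 2) * pi_coth x * Cseries1 (rhs_term1 x y)
  + (2 * pi_coth y + pi_coth x) * Cseries1 (rhs_term2 x y).

Definition den_nonzero (x y : C) : Prop :=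
  forall n : nat, (1 <= n)%nat -> den x y n <> 0.

(* The points where the right-hand side makes sense as it is written, with no
   convention for a removable singularity. *)
Definition generic (p : C * C) : Prop :=
  admissible (fst p) (snd p) /\ fst p <> 0 /\ snd p <> 0
  /\ den_nonzero (fst p) (snd p).

(* [l] is the limit of [f] at [p] along [D]; properness of the filter says that
   [p] is adherent to [D], so that the limit is not vacuous. *)
Definition is_limit_along (D : C * C -> Prop) (f : C * C -> C)
    (p : C * C) (l : C) : Prop :=
  let F := within D
    (locally (T := prod_UniformSpace C_UniformSpace C_UniformSpace) p) in
  ProperFilter F /\ filterlim f F (locally (T := C_UniformSpace) l).

(* Main.v *)
Require Import Defs.
From Stdlib Require Import Lra Lia Psatz List.

(** Put [h(r) = r / (r^2 + y^2)] and [Q_z(r) = z^2 / (r^2 + z^2)], [Q_z(0) = 1],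
    so that [pi z coth (pi z) = 1 + 2 sum_k Q_z(k)].  The coefficient of
    [1 / (k^2 + x^2)] on the left is [a_k = h(k) + 2 sum_(m < k) h(m)], and
    telescoping gives [sum_n (h(n+k) + h(n-k) - 2 h(n)) = - a_k].  On the right,
    the summand is built from [t_n], the same second difference of [h] with the
    step [k] replaced by [ix], divided by [- 2 x^2], and from [n / den x y n].
    For each [n], a partial fraction identity in [k] expresses
    [- (h(n+k) + h(n-k) - 2 h(n)) / (k^2 + x^2)] through [h(n+k) + h(n-k)],
    [Q_y(n+k) + Q_y(n-k)] and [t_n Q_x(k)]; summing over [k] gives
    [t_n pi x coth (pi x) + 2 (n / den x y n) pi y coth (pi y)].  Summing this over
    [n <= L] and letting [L] tend to infinity under the sum over [k], with majorant
    [harmonic k / k^2], proves the identity wherever no denominator vanishes,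
    including at [x = 0] and [y = 0].  The same majorant is locally uniform in
    [(x, y)], so the left-hand side is continuous, which gives the limit. *)

(** * Limits of complex functions along a filter, measured by [Cmod] *)

Definition clim {T : Type} (F : (T -> Prop) -> Prop) (f : T -> C) (l : C) : Prop :=
  forall eps : R, (0 < eps)%R -> F (fun t => (Cmod (f t - l) < eps)%R).

Lemma filterlim_clim {T : Type} (F : (T -> Prop) -> Prop) {FF : Filter F}
    (f : T -> C) (l : C) :
  filterlim f F (locally (T := C_UniformSpace) l) <-> clim F f l.
Proof.
  pose proof (filterlim_locally_ball_norm (K := C_AbsRing)
    (U := C_NormedModule) (F := F) f l) as H.
  split.
  - intros Hf eps He. generalize (proj1 H Hf (mkposreal eps He)). apply filter_imp.
    intros t Ht. exact Ht.
  - intros Hf. apply (proj2 H). intros eps. generalize (Hf eps (cond_pos eps)).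
    apply filter_imp. intros t Ht. exact Ht.
Qed.

Lemma clim_const {T : Type} (F : (T -> Prop) -> Prop) {FF : Filter F} (c : C) :
  clim F (fun _ => c) c.
Proof.
  intros eps He. apply filter_forall. intros _.
  replace (c - c) with (RtoC 0) by ring. rewrite Cmod_0. exact He.
Qed.

Lemma clim_ext {T : Type} (F : (T -> Prop) -> Prop) {FF : Filter F}
    (f g : T -> C) (l : C) :
  F (fun t => f t = g t) -> clim F f l -> clim F g l.
Proof.
  intros Hfg Hf eps He.
  generalize (filter_and _ _ Hfg (Hf eps He)). apply filter_imp.
  intros t [<- Ht]. exact Ht.
Qed.

Lemma clim_plus {T : Type} (F : (T -> Prop) -> Prop) {FF : Filter F}
    (f g : T -> C) (l m : C) :
  clim F f l -> clim F g m -> clim F (fun t => f t + g t) (l + m).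
Proof.
  intros Hf Hg eps He.
  assert (He2 : (0 < eps / 2)%R) by lra.
  generalize (filter_and _ _ (Hf _ He2) (Hg _ He2)). apply filter_imp.
  intros t [H1 H2].
  replace (f t + g t - (l + m)) with ((f t - l) + (g t - m)) by ring.
  eapply Rle_lt_trans. apply Cmod_triangle. lra.
Qed.

Lemma clim_mult {T : Type} (F : (T -> Prop) -> Prop) {FF : Filter F}
    (f g : T -> C) (l m : C) :
  clim F f l -> clim F g m -> clim F (fun t => f t * g t) (l * m).
Proof.
  intros Hf Hg eps He.
  set (A := (1 + Cmod l + Cmod m)%R).
  pose proof (Cmod_ge_0 l) as Hl. pose proof (Cmod_ge_0 m) as Hm.
  assert (HA : (1 <= A)%R) by (unfold A; lra).
  (* When both errors are below [d <= 1], the expanded product error is below [d * (d + Cmod m +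
     Cmod l) <= d * A <= eps]. *)
  set (d := Rmin 1 (eps / A)).
  assert (Hd : (0 < d)%R).
  { apply Rmin_pos; [lra|]. apply Rdiv_lt_0_compat; lra. }
  generalize (filter_and _ _ (Hf _ Hd) (Hg _ Hd)). apply filter_imp.
  intros t [H1 H2].
  replace (f t * g t - l * m)
    with ((f t - l) * (g t - m) + ((f t - l) * m + l * (g t - m))) by ring.
  eapply Rle_lt_trans. apply Cmod_triangle.
  eapply Rle_lt_trans. apply Rplus_le_compat_l. apply Cmod_triangle.
  rewrite !Cmod_mult.
  pose proof (Cmod_ge_0 (f t - l)) as H3. pose proof (Cmod_ge_0 (g t - m)) as H4.
  assert (Hd1 : (d <= 1)%R) by apply Rmin_l.
  assert (Hd2 : (d * A <= eps)%R).
  { apply Rle_trans with (eps / A * A)%R.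
    - apply Rmult_le_compat_r; [lra | apply Rmin_r].
    - right. field. lra. }
  unfold A in Hd2. nra.
Qed.

Lemma clim_inv {T : Type} (F : (T -> Prop) -> Prop) {FF : Filter F}
    (f : T -> C) (l : C) :
  l <> 0 -> clim F f l -> clim F (fun t => / f t) (/ l).
Proof.
  intros Hl Hf eps He.
  apply Cmod_gt_0 in Hl as Hl'. set (A := Cmod l) in *.
  (* The first bound keeps [Cmod (f t)] above [A / 2]; the second then makes the numerator smaller
     than [eps * Cmod (f t) * A]. *)
  set (d := Rmin (A / 2) (eps * (A * A) / 2)).
  assert (Hd : (0 < d)%R).
  { apply Rmin_pos; [lra|].
    assert (0 < eps * (A * A))%R by (apply Rmult_lt_0_compat; nra). lra. }
  generalize (Hf _ Hd). apply filter_imp. intros t Ht.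
  assert (H1 : (A / 2 < Cmod (f t))%R).
  { assert (Cmod l <= Cmod (f t) + Cmod (f t - l))%R.
    { replace l with (f t + - (f t - l)) at 1 by ring.
      eapply Rle_trans. apply Cmod_triangle. rewrite Cmod_opp. lra. }
    pose proof (Rmin_l (A / 2) (eps * (A * A) / 2)). unfold d in Ht.
    fold A in H. lra. }
  assert (Hft : f t <> 0) by (apply Cmod_gt_0; lra).
  replace (/ f t - / l) with (- (f t - l) / (f t * l)) by (field; auto).
  rewrite Cmod_div, Cmod_mult, Cmod_opp by (apply Cmult_neq_0; auto).
  fold A. apply (Rmult_lt_reg_r (Cmod (f t) * A)); [nra|].
  unfold Rdiv. rewrite Rmult_assoc, Rinv_l, Rmult_1_r by nra.
  pose proof (Rmin_r (A / 2) (eps * (A * A) / 2)). fold d in H.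
  apply Rlt_trans with d; [exact Ht|].
  apply Rle_lt_trans with (1 := H).
  assert (0 < eps * A)%R by nra. nra.
Qed.

Lemma clim_opp {T : Type} (F : (T -> Prop) -> Prop) {FF : Filter F}
    (f : T -> C) (l : C) :
  clim F f l -> clim F (fun t => - f t) (- l).
Proof.
  intros Hf eps He. generalize (Hf _ He). apply filter_imp. intros t Ht.
  replace (- f t - - l) with (- (f t - l)) by ring. rewrite Cmod_opp. exact Ht.
Qed.

Lemma clim_minus {T : Type} (F : (T -> Prop) -> Prop) {FF : Filter F}
    (f g : T -> C) (l m : C) :
  clim F f l -> clim F g m -> clim F (fun t => f t - g t) (l - m).
Proof.
  intros Hf Hg. apply clim_plus; [exact FF | exact Hf |].
  apply clim_opp; [exact FF | exact Hg].
Qed.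

Lemma clim_div {T : Type} (F : (T -> Prop) -> Prop) {FF : Filter F}
    (f g : T -> C) (l m : C) :
  m <> 0 -> clim F f l -> clim F g m -> clim F (fun t => f t / g t) (l / m).
Proof.
  intros Hm Hf Hg. apply clim_mult; [exact FF | exact Hf |].
  apply clim_inv; auto.
Qed.

(** Closed discs are stable under limits: properness supplies a point [t] where [f t] is both near
    [l] and in the disc. This is how termwise bounds pass to limits and to sums below. *)
Lemma clim_Cmod_le {T : Type} (F : (T -> Prop) -> Prop) {FF : ProperFilter F}
    (f : T -> C) (l c : C) (e : R) :
  clim F f l -> F (fun t => (Cmod (f t - c) <= e)%R) -> (Cmod (l - c) <= e)%R.
Proof.
  intros Hf Hc. apply Rnot_lt_le. intros Hlt.
  assert (He : (0 < Cmod (l - c) - e)%R) by lra.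
  destruct (filter_ex _ (filter_and _ _ (Hf _ He) Hc)) as [t [H1 H2]].
  assert (Cmod (l - c) <= Cmod (f t - l) + Cmod (f t - c))%R.
  { replace (l - c) with (- (f t - l) + (f t - c)) by ring.
    eapply Rle_trans. apply Cmod_triangle. rewrite Cmod_opp. lra. }
  lra.
Qed.

Lemma clim_unique {T : Type} (F : (T -> Prop) -> Prop) {FF : ProperFilter F}
    (f : T -> C) (l m : C) :
  clim F f l -> clim F f m -> l = m.
Proof.
  intros Hl Hm. apply Ceq_minus. apply Cmod_eq_0.
  apply Rle_antisym; [|apply Cmod_ge_0].
  apply le_epsilon. intros e He. rewrite Rplus_0_l.
  apply (clim_Cmod_le F f); [exact Hl|].
  generalize (Hm _ He). apply filter_imp. intros t Ht. lra.
Qed.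

(** * Series indexed from 1 *)

Fixpoint csum (u : nat -> C) (n : nat) : C :=
  match n with O => 0 | S p => csum u p + u (S p) end.

Lemma csum_S (u : nat -> C) (n : nat) : csum u (S n) = csum u n + u (S n).
Proof. reflexivity. Qed.

Definition has_sum (u : nat -> C) (l : C) : Prop := clim eventually (csum u) l.

Lemma csum_sum_n_m (u : nat -> C) (n : nat) :
  sum_n_m (G := C_AbelianMonoid) u 1 n = csum u n.
Proof.
  induction n as [|n IH].
  - now rewrite sum_n_m_zero by lia.
  - rewrite sum_n_Sm by lia. rewrite IH. reflexivity.
Qed.

Lemma csum_sum_n (u : nat -> C) (n : nat) :
  sum_n (G := C_AbelianMonoid) (fun k => u (S k)) n = csum u (S n).
Proof.
  induction n as [|n IH].
  - rewrite sum_O. simpl. ring.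
  - rewrite sum_Sn, IH. reflexivity.
Qed.

Lemma is_series_has_sum (u : nat -> C) (l : C) :
  is_series (V := C_NormedModule) (fun k => u (S k)) l <-> has_sum u l.
Proof.
  unfold is_series.
  pose proof (filterlim_clim eventually
    (sum_n (G := C_AbelianMonoid) (fun k => u (S k))) l) as H.
  split.
  - intros Hs eps He. destruct (proj1 H Hs eps He) as [N HN].
    exists (S N). intros [|n] Hn; [lia|].
    rewrite <- csum_sum_n. apply HN. lia.
  - intros Hs. apply (proj2 H). intros eps He. destruct (Hs eps He) as [N HN].
    exists N. intros n Hn. rewrite csum_sum_n. apply HN. lia.
Qed.

Lemma has_sum_unique (u : nat -> C) (l m : C) :
  has_sum u l -> has_sum u m -> l = m.
Proof. apply clim_unique, eventually_filter. Qed.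

Lemma Cseries1_has_sum (u : nat -> C) (l : C) :
  has_sum u l -> ex_Cseries1 u /\ Cseries1 u = l.
Proof.
  intros Hu. apply is_series_has_sum in Hu as Hs. split.
  - exists l. exact Hs.
  - unfold Cseries1. apply (iota_unique (V := C_CompleteNormedModule)).
    + intros m Hm. apply (has_sum_unique u); [|exact Hu].
      apply is_series_has_sum. exact Hm.
    + exact Hs.
Qed.

Lemma csum_ext (u v : nat -> C) (n : nat) :
  (forall k, (1 <= k <= n)%nat -> u k = v k) -> csum u n = csum v n.
Proof.
  induction n as [|n IH]; intros H; simpl; [reflexivity|].
  rewrite IH, (H (S n)) by (intros; try apply H; lia). reflexivity.
Qed.

Lemma has_sum_ext (u v : nat -> C) (l : C) :
  (forall k, (1 <= k)%nat -> u k = v k) -> has_sum u l -> has_sum v l.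
Proof.
  intros H. apply clim_ext; [apply eventually_filter|].
  apply filter_forall. intros n. apply csum_ext. intros k Hk. apply H. lia.
Qed.

Lemma csum_plus (u v : nat -> C) (n : nat) :
  csum (fun k => u k + v k) n = csum u n + csum v n.
Proof. induction n as [|n IH]; simpl; [|rewrite IH]; ring. Qed.

Lemma csum_scal (c : C) (u : nat -> C) (n : nat) :
  csum (fun k => c * u k) n = c * csum u n.
Proof. induction n as [|n IH]; simpl; [|rewrite IH]; ring. Qed.

Lemma has_sum_plus (u v : nat -> C) (l m : C) :
  has_sum u l -> has_sum v m -> has_sum (fun k => u k + v k) (l + m).
Proof.
  intros Hu Hv.
  apply clim_ext with (fun n => csum u n + csum v n); [apply eventually_filter| |].
  - apply filter_forall. intros n. now rewrite csum_plus.
  - apply clim_plus; [apply eventually_filter | exact Hu | exact Hv].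
Qed.

Lemma has_sum_scal (c : C) (u : nat -> C) (l : C) :
  has_sum u l -> has_sum (fun k => c * u k) (c * l).
Proof.
  intros Hu.
  apply clim_ext with (fun n => c * csum u n); [apply eventually_filter| |].
  - apply filter_forall. intros n. now rewrite csum_scal.
  - apply clim_mult; [apply eventually_filter | | exact Hu].
    apply clim_const, eventually_filter.
Qed.

Lemma has_sum_0 : has_sum (fun _ => 0) 0.
Proof.
  apply clim_ext with (fun _ => RtoC 0); [apply eventually_filter| |].
  - apply filter_forall. intros n. induction n as [|n IH]; simpl; [|rewrite <- IH]; ring.
  - apply clim_const, eventually_filter.
Qed.

(** Exchange of a finite sum with a series; it is used to add up the identities for fixed [n] over
    [n <= L]. *)
Lemma has_sum_csum (f : nat -> nat -> C) (l : nat -> C) (n : nat) :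
  (forall i, (1 <= i)%nat -> has_sum (f i) (l i)) ->
  has_sum (fun k => csum (fun i => f i k) n) (csum l n).
Proof.
  intros H. induction n as [|n IH]; simpl.
  - apply has_sum_0.
  - apply has_sum_plus; [exact IH|]. apply H. lia.
Qed.

(** * Dominated series and Tannery's theorem *)

Definition summable (M : nat -> R) : Prop := ex_series (fun k => M (S k)).

Lemma ex_has_sum (u : nat -> C) (M : nat -> R) :
  summable M -> (forall k, (1 <= k)%nat -> (Cmod (u k) <= M k)%R) ->
  exists l, has_sum u l.
Proof.
  intros HM Hu.
  destruct (ex_series_le (V := C_CompleteNormedModule)
    (fun k => u (S k)) (fun k => M (S k))) as [l Hl].
  - intros k. apply (Hu (S k)). lia.
  - exact HM.
  - exists l. apply is_series_has_sum. exact Hl.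
Qed.

(** The Cauchy index of the majorant is chosen before [u], so a single [N] controls the tails of a
    whole dominated family. *)
Lemma summable_tail (M : nat -> R) (e : R) :
  summable M -> (0 < e)%R ->
  exists N, forall (u : nat -> C) (K n : nat), (N <= K)%nat ->
    (forall k, (K < k)%nat -> (Cmod (u k) <= M k)%R) ->
    (Cmod (csum u (K + n) - csum u K) <= e)%R.
Proof.
  intros HM He.
  destruct (Cauchy_ex_series (K := R_AbsRing) (V := R_CompleteNormedModule) _ HM
    (mkposreal e He)) as [N HN].
  exists N. intros u K n HK Hu. destruct n as [|n].
  { rewrite Nat.add_0_r. replace (csum u K - csum u K) with (RtoC 0) by ring.
    rewrite Cmod_0. lra. }
  assert (H : (Cmod (csum u (K + S n) - csum u K)
    <= sum_n_m (G := R_AbelianMonoid) (fun k => M (S k)) K (K + n))%R).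
  { induction n as [|n IH].
    - rewrite Nat.add_0_r, sum_n_n.
      replace (K + 1)%nat with (S K) by lia. simpl.
      replace (csum u K + u (S K) - csum u K) with (u (S K)) by ring.
      apply Hu. lia.
    - replace (K + S (S n))%nat with (S (K + S n)) by lia. simpl csum.
      replace (csum u (K + S n) + u (S (K + S n)) - csum u K)
        with ((csum u (K + S n) - csum u K) + u (S (K + S n))) by ring.
      eapply Rle_trans. apply Cmod_triangle.
      rewrite Nat.add_succ_r, sum_n_Sm by lia. apply Rplus_le_compat.
      + rewrite <- Nat.add_succ_r. exact IH.
      + apply Hu. lia. }
  eapply Rle_trans. exact H.
  eapply Rle_trans; [apply Rle_abs|]. left. apply HN; lia.
Qed.

(** Dominated convergence for series. Beyond a common index all tails are small, and what remains is
    a finite sum, where the limit is taken term by term. The offset [K0] lets the domination fail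
    for finitely many indices, as happens in the expansion of coth. *)
Lemma tannery {T : Type} (F : (T -> Prop) -> Prop) {FF : ProperFilter F}
    (f : T -> nat -> C) (g : nat -> C) (M : nat -> R) (K0 : nat)
    (s : T -> C) (l : C) :
  summable M ->
  F (fun t => forall k, (K0 < k)%nat -> (Cmod (f t k) <= M k)%R) ->
  (forall k, (1 <= k)%nat -> clim F (fun t => f t k) (g k)) ->
  F (fun t => has_sum (f t) (s t)) ->
  has_sum g l ->
  clim F s l.
Proof.
  intros HM HfM Hfg Hf Hg eps He.
  assert (He4 : (0 < eps / 4)%R) by lra.
  destruct (summable_tail M (eps / 4) HM He4) as [N HN].
  set (K := Nat.max N K0).
  (* The limit terms inherit the majorant, since closed discs are stable under limits. *)
  assert (HgM : forall k, (K0 < k)%nat -> (Cmod (g k) <= M k)%R).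
  { intros k Hk. replace (g k) with (g k - 0) by ring.
    apply (clim_Cmod_le F (fun t => f t k)); [apply Hfg; lia|].
    generalize HfM. apply filter_imp. intros t Ht.
    replace (f t k - 0) with (f t k) by ring. apply Ht, Hk. }
  assert (tail : forall (u : nat -> C) (m : C),
    (forall k, (K0 < k)%nat -> (Cmod (u k) <= M k)%R) -> has_sum u m ->
    (Cmod (m - csum u K) <= eps / 4)%R).
  { intros u m Hu Hm.
    apply (clim_Cmod_le eventually (csum u)); [exact Hm|].
    exists K. intros n Hn.
    replace n with (K + (n - K))%nat by lia.
    apply HN; [unfold K; lia|]. intros k Hk. apply Hu. unfold K in Hk. lia. }
  assert (Hfin : clim F (fun t => csum (f t) K) (csum g K)).
  { clear - FF Hfg. induction K as [|K IH]; simpl.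
    - apply clim_const. apply FF.
    - apply clim_plus; [apply FF | exact IH | apply Hfg; lia]. }
  (* Three errors of at most [eps / 4]: the tail of [f t], the finite part, the tail of [g]. *)
  generalize (filter_and _ _ (filter_and _ _ HfM Hf) (Hfin _ He4)).
  apply filter_imp. intros t [[H1 H2] H3].
  pose proof (tail _ _ H1 H2) as H4. pose proof (tail _ _ HgM Hg) as H5.
  replace (s t - l) with ((s t - csum (f t) K)
    + ((csum (f t) K - csum g K) + - (l - csum g K))) by ring.
  eapply Rle_lt_trans. apply Cmod_triangle.
  eapply Rle_lt_trans. apply Rplus_le_compat_l, Cmod_triangle.
  rewrite Cmod_opp. lra.
Qed.

(** The partial sums increase and stay below [b 1], because the differences of [b] telescope and [b]
    is nonnegative. *)
Lemma summable_telescope (M b : nat -> R) :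
  (forall k, (1 <= k)%nat -> (0 <= M k <= b k - b (S k))%R) ->
  (forall k, (1 <= k)%nat -> (0 <= b k)%R) ->
  summable M.
Proof.
  intros HM Hb.
  destruct (ex_finite_lim_seq_incr
    (sum_n (G := R_AbelianMonoid) (fun k => M (S k))) (b 1%nat)) as [l Hl].
  - intros n. rewrite sum_Sn. unfold plus; simpl.
    destruct (HM (S (S n))); [lia|]. lra.
  - intros n.
    assert (sum_n (G := R_AbelianMonoid) (fun k => M (S k)) n
      <= b 1%nat - b (S (S n)))%R.
    { induction n as [|n IH].
      - rewrite sum_O. apply HM. lia.
      - rewrite sum_Sn. unfold plus; simpl. destruct (HM (S (S n))); [lia|]. lra. }
    assert (0 <= b (S (S n)))%R by (apply Hb; lia). lra.
  - exists l. exact Hl.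
Qed.

Lemma summable_scal (c : R) (M : nat -> R) :
  summable M -> summable (fun k => c * M k)%R.
Proof.
  intros H. apply (ex_series_scal (K := R_AbsRing) (V := R_NormedModule) c
    (fun k => M (S k)) H).
Qed.

Lemma has_sum_finite (u : nat -> C) (N : nat) :
  (forall k, (N < k)%nat -> u k = 0) -> has_sum u (csum u N).
Proof.
  intros Hu. apply clim_ext with (fun _ => csum u N); [apply eventually_filter| |].
  - exists N. intros n Hn. replace n with (N + (n - N))%nat by lia.
    induction (n - N)%nat as [|m IH].
    + now rewrite Nat.add_0_r.
    + rewrite Nat.add_succ_r, csum_S, <- IH, Hu by lia. ring.
  - apply clim_const, eventually_filter.
Qed.

(** * Quadratic lower bounds and the harmonic majorant *)

Lemma Cmod_INR (n : nat) : Cmod (INR n) = INR n.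
Proof. rewrite Cmod_R. apply Rabs_pos_eq, pos_INR. Qed.

Lemma INR_ge_1 (n : nat) : (1 <= n)%nat -> (1 <= INR n)%R.
Proof. intros H. apply (le_INR 1 n H). Qed.

Lemma finite_lower_bound (e : nat -> R) (N : nat) :
  (forall n, (1 <= n)%nat -> (0 < e n)%R) ->
  exists d, (0 < d)%R /\ forall n, (1 <= n <= N)%nat -> (d <= e n)%R.
Proof.
  intros He. induction N as [|N [d [Hd IH]]].
  - exists 1%R. split; [lra|]. intros n Hn. lia.
  - exists (Rmin d (e (S N))). split.
    + apply Rmin_pos; [exact Hd | apply He; lia].
    + intros n Hn. destruct (Nat.eq_dec n (S N)) as [->|Hne].
      * apply Rmin_r.
      * eapply Rle_trans; [apply Rmin_l | apply IH; lia].
Qed.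

Lemma Cmod_minus_ge (a b : C) : (Cmod a - Cmod b <= Cmod (a + b))%R.
Proof.
  assert (Cmod a <= Cmod (a + b) + Cmod b)%R; [|lra].
  replace a with ((a + b) + - b) at 1 by ring.
  eapply Rle_trans; [apply Cmod_triangle|]. rewrite Cmod_opp. lra.
Qed.

(** For large [n] the square dominates [w']; the finitely many remaining [n] have a positive minimum
    of [Cmod (INR n ^ 2 + w)]. Letting [w'] move near [w] makes the later estimates locally uniform
    in [x] and [y]. *)
Lemma sqr_plus_lower_bound (w : C) :
  (forall n : nat, (1 <= n)%nat -> INR n ^ 2 + w <> 0) ->
  exists c d : R, (0 < c)%R /\ (0 < d)%R /\
    forall w' : C, (Cmod (w' - w) < d)%R ->
    forall n : nat, (1 <= n)%nat -> (c * INR n ^ 2 <= Cmod (INR n ^ 2 + w'))%R.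
Proof.
  intros Hw.
  destruct (INR_unbounded (2 * (Cmod w + 1))) as [N HN].
  destruct (finite_lower_bound (fun n => Cmod (INR n ^ 2 + w)) N) as [d [Hd Hb]].
  { intros n Hn. apply Cmod_gt_0, Hw, Hn. }
  pose proof (Cmod_ge_0 w) as Hw0.
  assert (HN1 : (0 < INR N)%R) by lra.
  (* The value [1 / 2] serves [n > N]. For [n <= N] half of the minimum [d] survives the
     perturbation, and [INR n ^ 2 <= INR N ^ 2]. *)
  set (c := Rmin (1 / 2) (d / 2 / INR N ^ 2)).
  exists c, (Rmin 1 (d / 2)).
  assert (Hc0 : (0 < c)%R).
  { apply Rmin_pos; [lra|]. apply Rdiv_lt_0_compat; [lra|]. apply pow_lt, HN1. }
  split; [exact Hc0|].
  split; [apply Rmin_pos; lra|].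
  intros w' Hw' n Hn.
  pose proof (Rmin_l 1 (d / 2)). pose proof (Rmin_r 1 (d / 2)).
  pose proof (INR_ge_1 n Hn) as Hn1.
  destruct (Nat.le_gt_cases n N) as [Hle|Hlt].
  - apply le_INR in Hle as Hle'.
    assert (d <= Cmod (INR n ^ 2 + w))%R by (apply Hb; lia).
    replace (INR n ^ 2 + w') with ((INR n ^ 2 + w) + (w' - w)) by ring.
    eapply Rle_trans; [|apply Cmod_minus_ge].
    apply Rle_trans with (d / 2)%R; [|lra].
    apply Rle_trans with (d / 2 / INR N ^ 2 * INR N ^ 2)%R.
    + apply Rmult_le_compat; [lra | apply pow_le; lra | apply Rmin_r |].
      apply pow_incr. lra.
    + right. field. lra.
  - apply lt_INR in Hlt.
    eapply Rle_trans; [|apply Cmod_minus_ge].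
    rewrite <- RtoC_pow, Cmod_R, Rabs_pos_eq by (apply pow_le; lra).
    assert (Cmod w' <= Cmod w + 1)%R.
    { replace w' with (w + (w' - w)) by ring.
      eapply Rle_trans; [apply Cmod_triangle|]. lra. }
    assert (c <= 1 / 2)%R by apply Rmin_l.
    assert (c * INR n ^ 2 <= 1 / 2 * INR n ^ 2)%R.
    { apply Rmult_le_compat_r; [apply pow_le; lra | lra]. }
    simpl in *. nra.
Qed.

Fixpoint harmonic (n : nat) : R :=
  match n with O => 0%R | S p => (harmonic p + / INR (S p))%R end.

Lemma harmonic_S (n : nat) : harmonic (S n) = (harmonic n + / INR (S n))%R.
Proof. reflexivity. Qed.

Lemma harmonic_incr (m n : nat) : (m <= n)%nat -> (harmonic m <= harmonic n)%R.
Proof.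
  induction 1 as [|n H IH]; [lra|]. rewrite harmonic_S.
  assert (0 < / INR (S n))%R by (apply Rinv_0_lt_compat, lt_0_INR; lia). lra.
Qed.

Lemma harmonic_ge_1 (n : nat) : (1 <= n)%nat -> (1 <= harmonic n)%R.
Proof.
  intros H. replace 1%R with (harmonic 1) by (simpl; lra).
  apply harmonic_incr, H.
Qed.

Lemma summable_harmonic : summable (fun k => harmonic k / INR k ^ 2)%R.
Proof.
  (* A discrete form of the tail integral of [ln t / t ^ 2] from [k] on, which is [(ln k + 1) / k];
     the factor 2 absorbs the discretisation. *)
  apply summable_telescope with (fun k => 2 * ((harmonic k + 1) / INR k))%R.
  - intros k Hk. pose proof (INR_ge_1 k Hk) as H1.
    pose proof (harmonic_ge_1 k Hk) as H2.
    split.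
    + apply Rdiv_le_0_compat; [lra|]. apply pow_lt. lra.
    + rewrite harmonic_S, S_INR. set (x := INR k) in *. set (H := harmonic k) in *.
      apply Rminus_le_0.
      replace (2 * ((H + 1) / x) - 2 * ((H + / (x + 1) + 1) / (x + 1)) - H / x ^ 2)%R
        with ((H * (x ^ 2 - 1) + 2 * x) / (x ^ 2 * (x + 1) ^ 2))%R by (field; lra).
      apply Rdiv_le_0_compat.
      * assert (1 <= x ^ 2)%R by nra. nra.
      * apply Rmult_lt_0_compat; apply pow_lt; lra.
  - intros k Hk. pose proof (INR_ge_1 k Hk). pose proof (harmonic_ge_1 k Hk).
    apply Rmult_le_pos; [lra|]. apply Rdiv_le_0_compat; lra.
Qed.

(** Since [harmonic k >= 1], the harmonic majorant also covers terms of order [1 / k ^ 2]. *)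
Lemma ex_has_sum_inv_sqr (u : nat -> C) (c : R) :
  (forall k, (1 <= k)%nat -> (Cmod (u k) <= c / INR k ^ 2)%R) ->
  exists l, has_sum u l.
Proof.
  intros Hu.
  apply (ex_has_sum u (fun k => c * (harmonic k / INR k ^ 2))%R).
  - apply summable_scal, summable_harmonic.
  - intros k Hk. eapply Rle_trans; [apply Hu, Hk|].
    pose proof (INR_ge_1 k Hk). pose proof (harmonic_ge_1 k Hk).
    assert (0 < / INR k ^ 2)%R by (apply Rinv_0_lt_compat, pow_lt; lra).
    (* The hypothesis at [k = 1] bounds a modulus by [c]. *)
    assert (0 <= c)%R.
    { specialize (Hu 1%nat (le_n _)). simpl in Hu.
      pose proof (Cmod_ge_0 (u 1%nat)). lra. }
    unfold Rdiv. apply Rmult_le_compat_l; [exact H2|].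
    rewrite <- (Rmult_1_l (/ INR k ^ 2)) at 1.
    apply Rmult_le_compat_r; lra.
Qed.

(** * The partial fraction expansion of coth *)

Ltac Ccomp := apply injective_projections; simpl; unfold Re, Im; simpl.

Lemma Cexp_0 : Cexp 0 = 1.
Proof. unfold Cexp. Ccomp; rewrite exp_0, ?cos_0, ?sin_0; ring. Qed.

Lemma Cexp_plus (a b : C) : Cexp (a + b) = Cexp a * Cexp b.
Proof.
  unfold Cexp. Ccomp; rewrite exp_plus, ?cos_plus, ?sin_plus; ring.
Qed.

Lemma Cexp_opp_mult (a : C) : Cexp a * Cexp (- a) = 1.
Proof. rewrite <- Cexp_plus, Cplus_opp_r. apply Cexp_0. Qed.

Lemma Ccosh_sinh_sqr (a : C) : Ccosh a ^ 2 - Csinh a ^ 2 = 1.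
Proof.
  unfold Ccosh, Csinh. rewrite <- (Cexp_opp_mult a). field.
Qed.

Lemma Csinh_double (a : C) : Csinh (2 * a) = 2 * Csinh a * Ccosh a.
Proof.
  unfold Ccosh, Csinh. replace (- (2 * a)) with (- a + - a) by ring.
  replace (2 * a) with (a + a) by ring. rewrite !Cexp_plus. field.
Qed.

Lemma Ccosh_double (a : C) : Ccosh (2 * a) = 2 * Ccosh a ^ 2 - 1.
Proof.
  unfold Ccosh, Csinh. replace (- (2 * a)) with (- a + - a) by ring.
  replace (2 * a) with (a + a) by ring. rewrite !Cexp_plus.
  rewrite <- (Cexp_opp_mult a). field.
Qed.

Lemma Ccosh_double_sinh (a : C) : Ccosh (2 * a) = 1 + 2 * Csinh a ^ 2.
Proof.
  rewrite Ccosh_double.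
  replace (Ccosh a ^ 2) with (Ccosh a ^ 2 - Csinh a ^ 2 + Csinh a ^ 2) by ring.
  rewrite Ccosh_sinh_sqr. ring.
Qed.

Lemma Csinh_imaginary (t : R) : Csinh (Ci * t) = Ci * sin t.
Proof.
  unfold Csinh, Cexp.
  replace (Re (Ci * t)) with 0%R by (simpl; ring).
  replace (Im (Ci * t)) with t by (simpl; ring).
  replace (Re (- (Ci * t))) with 0%R by (simpl; ring).
  replace (Im (- (Ci * t))) with (- t)%R by (simpl; ring).
  rewrite exp_0, cos_neg, sin_neg.
  replace ((cos t, (- sin t)%R) : C) with (cos t - Ci * sin t)
    by (Ccomp; ring).
  replace ((cos t, sin t) : C) with (cos t + Ci * sin t)
    by (Ccomp; ring).
  field.
Qed.

(** A zero of sinh satisfies [Cexp (w + w) = 1]; the modulus forces the real part of [w] to vanish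
    and the argument makes its imaginary part a multiple of [PI]. *)
Lemma Csinh_eq_0 (w : C) :
  Csinh w = 0 -> exists k : Z, w = Ci * (IZR k * PI)%R.
Proof.
  intros H.
  assert (H2 : Cexp (w + w) = 1).
  { rewrite Cexp_plus. rewrite <- (Cexp_opp_mult w) at 1.
    replace (Cexp w) with (2 * Csinh w + Cexp (- w)) at 2
      by (unfold Csinh; field).
    rewrite H. rewrite Cmult_0_r, Cplus_0_l. reflexivity. }
  unfold Cexp in H2. injection H2 as H3 H4. simpl in H3, H4.
  unfold Re, Im in H3, H4.
  set (a := fst w) in *. set (b := snd w) in *. simpl in H3, H4.
  pose proof (exp_pos (a + a)) as He.
  assert (Hs : sin (b + b) = 0%R) by nra.
  assert (Hc : (exp (a + a) * cos (b + b) = 1)%R) by nra.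
  pose proof (sin2_cos2 (b + b)) as Hsc. rewrite Hs in Hsc.
  unfold Rsqr in Hsc.
  (* The sine vanishes, so the cosine is 1 or -1; positivity of the exponential selects 1. *)
  assert (Hc1 : cos (b + b) = 1%R) by nra.
  assert (Ha : a = 0%R).
  { rewrite Hc1, Rmult_1_r, <- exp_0 in Hc. apply exp_inv in Hc. lra. }
  assert (Hb : sin b = 0%R).
  { replace (b + b)%R with (2 * b)%R in Hc1 by ring.
    rewrite cos_2a_sin in Hc1. nra. }
  destruct (sin_eq_0_0 b Hb) as [k Hk]. exists k.
  rewrite (surjective_pairing w). fold a b. rewrite Ha, Hk. Ccomp; ring.
Qed.

Lemma csum_reflect (u : nat -> C) (m j : nat) :
  (j <= m)%nat ->
  csum (fun k => u (S m - k)%nat) j = csum u m - csum u (m - j).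
Proof.
  induction j as [|j IH]; intros Hj.
  - rewrite Nat.sub_0_r. simpl. ring.
  - rewrite csum_S, IH by lia.
    replace (m - j)%nat with (S (m - S j)) by lia. rewrite csum_S.
    replace (S m - S j)%nat with (S (m - S j)) by lia. ring.
Qed.

(** Folding about the midpoint [m + 1]; this pairs [k] with [2 * M - k] in the doubling step for
    coth. *)
Lemma csum_fold (u : nat -> C) (m : nat) :
  csum u (2 * m + 1) =
  csum (fun k => u k + u (2 * m + 2 - k)%nat) m + u (S m).
Proof.
  rewrite csum_plus.
  rewrite (csum_ext (fun k => u (2 * m + 2 - k)%nat)
    (fun k => u (S (2 * m + 1) - k)%nat))
    by (intros; f_equal; lia).
  rewrite csum_reflect by lia.
  replace (2 * m + 1 - m)%nat with (S m) by lia. rewrite csum_S. ring.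
Qed.

(* By repeated use of [2 coth (2 a) = coth a + tanh a]. *)
Lemma coth_pow2 (p : nat) (a : C) :
  let M := (2 ^ p)%nat in
  Csinh (INR M * a) <> 0 ->
  Csinh a <> 0
  /\ (forall k, (1 <= k < M)%nat -> Ccosh a - cos (PI * INR k / INR M) <> 0)
  /\ INR M * Ccoth (INR M * a) = Ccoth a
     + csum (fun k => Csinh a / (Ccosh a - cos (PI * INR k / INR M))) (M - 1).
Proof.
  revert a. induction p as [|p IH]; intros a M HM; unfold M in *; clear M.
  - simpl in *. rewrite Cmult_1_l in HM.
    split; [exact HM|]. split; [lia|].
    rewrite !Cmult_1_l. ring.
  - replace (2 ^ S p)%nat with (2 * 2 ^ p)%nat in * by reflexivity.
    set (M := (2 ^ p)%nat) in *.
    assert (HM1 : (1 <= M)%nat) by (unfold M; clear; induction p; simpl; lia).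
    assert (HMpos : (0 < INR M)%R) by (apply lt_0_INR; lia).
    assert (H2M : INR (2 * M) * a = INR M * (2 * a)).
    { rewrite mult_INR, RtoC_mult. simpl INR.
      replace (1 + 1)%R with 2%R by ring. ring. }
    rewrite H2M in *.
    destruct (IH (2 * a)) as [Hs [Hk Hsum]]; [exact HM|]. fold M in Hk, Hsum.
    rewrite Csinh_double in Hs.
    assert (Hsa : Csinh a <> 0).
    { intros E. apply Hs. rewrite E. ring. }
    assert (Hca : Ccosh a <> 0).
    { intros E. apply Hs. rewrite E. ring. }
    set (c := fun k => RtoC (cos (PI * INR k / INR (2 * M)))).
    assert (Hmid : c M = 0).
    { unfold c. rewrite mult_INR. simpl (INR 2).
      replace (PI * INR M / ((1 + 1) * INR M))%R with (PI / 2)%R by (field; lra).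
      rewrite cos_PI2. reflexivity. }
    assert (Hrefl : forall k, (k <= 2 * M)%nat -> c (2 * M - k)%nat = - c k).
    { intros k Hk2. unfold c. rewrite <- RtoC_opp. f_equal.
      rewrite minus_INR by lia.
      replace (PI * (INR (2 * M) - INR k) / INR (2 * M))%R
        with (- (PI * INR k / INR (2 * M)) + PI)%R
        by (rewrite mult_INR; simpl (INR 2); field; lra).
      rewrite neg_cos, cos_neg. reflexivity. }
    (* With c the cosine of the halved angle, cosh 2a - cos 2t = 2 (cosh a - c) (cosh a + c), so
       each denominator for [2 * a] splits into two denominators for [a]. *)
    assert (Hdbl : forall k, Ccosh (2 * a) - cos (PI * INR k / INR M)
        = 2 * ((Ccosh a - c k) * (Ccosh a + c k))).
    { intros k. rewrite Ccosh_double. unfold c.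
      replace (PI * INR k / INR M)%R
        with (2 * (PI * INR k / INR (2 * M)))%R
        by (rewrite mult_INR; simpl (INR 2); field; lra).
      rewrite cos_2a_cos, RtoC_minus, !RtoC_mult. ring. }
    assert (Hlow : forall k, (1 <= k < M)%nat ->
        Ccosh a - c k <> 0 /\ Ccosh a + c k <> 0).
    { intros k Hk2. specialize (Hk k Hk2). rewrite Hdbl in Hk.
      split; intros E; apply Hk; rewrite E; ring. }
    assert (Hnz : forall k, (1 <= k < 2 * M)%nat -> Ccosh a - c k <> 0).
    { intros k Hk2. destruct (Nat.lt_trichotomy k M) as [H|[H|H]].
      - apply Hlow. lia.
      - rewrite H, Hmid. replace (Ccosh a - 0) with (Ccosh a) by ring. exact Hca.
      - replace k with (2 * M - (2 * M - k))%nat by lia.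
        rewrite Hrefl by lia.
        replace (Ccosh a - - c (2 * M - k)%nat)
          with (Ccosh a + c (2 * M - k)%nat) by ring.
        apply Hlow. lia. }
    split; [exact Hsa|]. split; [exact Hnz|].
    replace (RtoC (INR (2 * M))) with (2 * INR M)
      by (rewrite mult_INR, RtoC_mult; simpl INR; do 2 f_equal; ring).
    rewrite <- Cmult_assoc, Hsum.
    (* By the reflection [Hrefl], the terms [k] and [2 * M - k] add up to twice the term [k] of the
       expansion at [2 * a]; the middle term [k = M], where the cosine is 0, is tanh a. *)
    replace (2 * M - 1)%nat with (2 * (M - 1) + 1)%nat by lia.
    rewrite csum_fold. replace (S (M - 1)) with M by lia.
    cbv beta. fold (c M). rewrite Hmid.
    rewrite Cmult_plus_distr_l, <- csum_scal.
    rewrite (csum_ext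
      (fun k => 2 * (Csinh (2 * a) / (Ccosh (2 * a) - cos (PI * INR k / INR M))))
      (fun k => Csinh a / (Ccosh a - cos (PI * INR k / INR (2 * M)))
        + Csinh a / (Ccosh a - cos (PI * INR (2 * (M - 1) + 2 - k) / INR (2 * M))))).
    + unfold Ccoth. rewrite Csinh_double.
      replace (Ccosh (2 * a)) with (Ccosh a ^ 2 + Csinh a ^ 2).
      2:{ rewrite Ccosh_double_sinh, <- (Ccosh_sinh_sqr a). ring. }
      field. auto.
    + intros k Hk2. fold (c k).
      replace (2 * (M - 1) + 2 - k)%nat with (2 * M - k)%nat by lia.
      fold (c (2 * M - k)%nat). rewrite Hrefl by lia.
      rewrite Hdbl, Csinh_double.
      destruct (Hlow k) as [H1 H2]; [lia|].
      replace (Ccosh a - - c k) with (Ccosh a + c k) by ring.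
      field. auto.
Qed.

(** * Limits of hyperbolic quotients at small arguments *)

Lemma is_derive_quotient (f : R -> R) (l : R) (e : R) :
  is_derive f 0 l -> (0 < e)%R ->
  exists d, (0 < d)%R /\ forall h, (0 < h < d)%R ->
    (Rabs ((f h - f 0) / h - l) < e)%R.
Proof.
  intros Hf He. apply is_derive_Reals in Hf.
  destruct (Hf e He) as [d Hd]. exists d. split; [apply cond_pos|].
  intros h Hh. specialize (Hd h). rewrite Rplus_0_l in Hd. apply Hd; [lra|].
  rewrite Rabs_pos_eq; lra.
Qed.

Definition tends_to_0_plus {T : Type} (F : (T -> Prop) -> Prop) (h : T -> R) : Prop :=
  forall d : R, (0 < d)%R -> F (fun t => (0 < h t < d)%R).

Lemma clim_Cexp_quotient {T : Type} (F : (T -> Prop) -> Prop) {FF : Filter F}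
    (h : T -> R) (z : C) :
  tends_to_0_plus F h ->
  clim F (fun t => (Cexp (h t * z) - 1) / h t) z.
Proof.
  intros h_small eps He. destruct z as [a b].
  destruct (is_derive_quotient (fun t => exp (t * a) * cos (t * b))%R a (eps / 2))
    as [d1 [Hd1 H1]].
  { auto_derive; [trivial|]. rewrite !Rmult_0_l, exp_0, cos_0, sin_0. ring. }
  { lra. }
  destruct (is_derive_quotient (fun t => exp (t * a) * sin (t * b))%R b (eps / 2))
    as [d2 [Hd2 H2]].
  { auto_derive; [trivial|]. rewrite !Rmult_0_l, exp_0, cos_0, sin_0. ring. }
  { lra. }
  generalize (filter_and _ _ (h_small _ Hd1) (h_small _ Hd2)).
  apply filter_imp. intros t [Ht1 Ht2].
  specialize (H1 _ Ht1). specialize (H2 _ Ht2). cbv beta in H1, H2.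
  set (u := ((exp (h t * a) * cos (h t * b) - 1) / h t - a)%R).
  set (v := (exp (h t * a) * sin (h t * b) / h t - b)%R).
  assert (Hu : (Rabs u < eps / 2)%R).
  { replace u with ((exp (h t * a) * cos (h t * b)
      - exp (0 * a) * cos (0 * b)) / h t - a)%R; [exact H1|].
    unfold u. rewrite (Rmult_0_l a), (Rmult_0_l b), exp_0, cos_0. field. lra. }
  assert (Hv : (Rabs v < eps / 2)%R).
  { replace v with ((exp (h t * a) * sin (h t * b)
      - exp (0 * a) * sin (0 * b)) / h t - b)%R; [exact H2|].
    unfold v. rewrite (Rmult_0_l a), (Rmult_0_l b), exp_0, sin_0. field. lra. }
  replace ((Cexp (h t * (a, b)) - 1) / h t - (a, b)) with (RtoC u + Ci * RtoC v).
  - eapply Rle_lt_trans; [apply Cmod_triangle|].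
    rewrite Cmod_mult, Cmod_Ci, !Cmod_R. lra.
  - unfold Cexp, u, v. simpl. Ccomp; rewrite ?Rmult_0_l, ?Rminus_0_r, ?Rplus_0_r. all: field; lra.
Qed.

Lemma clim_Csinh_quotient {T : Type} (F : (T -> Prop) -> Prop) {FF : Filter F}
    (h : T -> R) (z : C) :
  tends_to_0_plus F h -> clim F (fun t => Csinh (h t * z) / h t) z.
Proof.
  intros h_small.
  apply clim_ext with (fun t => ((Cexp (h t * z) - 1) / h t
    - (Cexp (h t * (- z)) - 1) / h t) / 2); [exact FF| |].
  - generalize (h_small 1 Rlt_0_1). apply filter_imp. intros t Ht.
    assert (RtoC (h t) <> 0) by (intros E; apply RtoC_inj in E; lra).
    unfold Csinh. replace (- (h t * z)) with (h t * - z) by ring. field. exact H.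
  - apply (eq_ind ((z - - z) / 2) (clim F _)); [|field].
    apply clim_div; [exact FF | intros E; apply RtoC_inj in E; lra | |].
    + apply clim_minus; [exact FF | |]; apply clim_Cexp_quotient; assumption.
    + apply clim_const, FF.
Qed.

Lemma clim_Ccosh {T : Type} (F : (T -> Prop) -> Prop) {FF : Filter F}
    (h : T -> R) (z : C) :
  tends_to_0_plus F h -> clim F (fun t => Ccosh (h t * z)) 1.
Proof.
  intros h_small.
  apply clim_ext with (fun t => 1 + 2 * ((h t : C) * (Csinh (h t * (z / 2)) / h t)) ^ 2);
    [exact FF | |].
  - generalize (h_small 1 Rlt_0_1). apply filter_imp. intros t Ht.
    assert (RtoC (h t) <> 0) by (intros E; apply RtoC_inj in E; lra).
    replace (h t * z) with (2 * (h t * (z / 2))) by field.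
    rewrite Ccosh_double_sinh. field. exact H.
  - apply (eq_ind (1 + 2 * ((0 * (z / 2)) * ((0 * (z / 2)) * 1))) (clim F _)); [|ring].
    assert (H : clim F (fun t => (h t : C) * (Csinh (h t * (z / 2)) / h t))
      (0 * (z / 2))).
    { apply clim_mult; [exact FF | | apply clim_Csinh_quotient; assumption].
      intros eps He. generalize (h_small _ He). apply filter_imp. intros t Ht.
      replace (h t - 0) with (RtoC (h t)) by ring.
      rewrite Cmod_R, Rabs_pos_eq; lra. }
    apply clim_plus; [exact FF | apply clim_const, FF |].
    apply clim_mult; [exact FF | apply clim_const, FF |].
    apply clim_mult; [exact FF | exact H |].
    apply clim_mult; [exact FF | exact H | apply clim_const, FF].
Qed.

(** Both functions are written as [1 + 2 sinh ^ 2] of the half argument, the cosine through sinh at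
    an imaginary argument, so the limit of the sinh quotient settles both. *)
Lemma clim_Ccosh_minus_cos {T : Type} (F : (T -> Prop) -> Prop) {FF : Filter F}
    (h : T -> R) (w : C) (s : R) :
  tends_to_0_plus F h ->
  clim F (fun t => (Ccosh (h t * w) - cos (s * h t)) / h t ^ 2)
    ((w ^ 2 + s ^ 2) / 2).
Proof.
  intros h_small.
  apply clim_ext with (fun t => 2 * ((Csinh (h t * (w / 2)) / h t) ^ 2)
     - 2 * ((Csinh (h t * (Ci * s / 2)) / h t) ^ 2)); [exact FF | |].
  - generalize (h_small 1 Rlt_0_1). apply filter_imp. intros t Ht.
    assert (RtoC (h t) <> 0) by (intros E; apply RtoC_inj in E; lra).
    replace (h t * (Ci * s / 2)) with (Ci * RtoC (s * h t / 2))
      by (rewrite RtoC_div, RtoC_mult by lra; field).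
    rewrite Csinh_imaginary.
    replace (h t * w) with (2 * (h t * (w / 2))) by field.
    rewrite Ccosh_double_sinh.
    replace (s * h t)%R with (2 * (s * h t / 2))%R by field.
    rewrite cos_2a_sin.
    replace (2 * (s * h t / 2) / 2)%R with (s * h t / 2)%R by field.
    rewrite RtoC_minus, !RtoC_mult.
    assert (E : Ci ^ 2 = - 1) by (Ccomp; ring).
    set (S := RtoC (sin _)).
    transitivity (2 * (Csinh (h t * (w / 2)) / h t) ^ 2 - 2 * (Ci ^ 2 * (S / h t) ^ 2)).
    + field. exact H.
    + rewrite E. field. exact H.
  - assert (E : Ci * Ci = - (1)) by (Ccomp; ring).
    replace ((w ^ 2 + s ^ 2) / 2) with
      (2 * (w / 2 * (w / 2 * 1)) - 2 * ((Ci * s / 2) * ((Ci * s / 2) * 1))).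
    2:{ replace (Ci * s / 2 * (Ci * s / 2 * 1)) with ((Ci * Ci) * (s / 2 * (s / 2)))
          by field. rewrite E. field. }
    assert (sq : forall z, clim F (fun t => 2 * (Csinh (h t * z) / h t) ^ 2)
      (2 * (z * (z * 1)))).
    { intros z. apply clim_mult; [exact FF | apply clim_const, FF |].
      apply clim_mult; [exact FF | apply clim_Csinh_quotient; assumption |].
      apply clim_mult; [exact FF | apply clim_Csinh_quotient; assumption | apply clim_const, FF]. }
    apply clim_minus; [exact FF | apply sq | apply sq].
Qed.

Lemma sin_ge_third (t : R) : (0 <= t <= PI / 2)%R -> (t / 3 <= sin t)%R.
Proof.
  intros Ht. pose proof PI_4.
  (* The Taylor bound [t - t ^ 3 / 6 <= sin t], combined with [t ^ 2 <= 4] on this interval. *)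
  destruct (pre_sin_bound t 0) as [Hs _]; [lra|lra|].
  unfold sin_approx, sin_term in Hs. simpl in Hs.
  assert (t ^ 2 <= 4)%R by nra.
  eapply Rle_trans; [|exact Hs].
  replace (1 * (t * 1 / 1) + -1 * 1 * (t * (t * (t * 1)) / (1 + 1 + 1 + 1 + 1 + 1)))%R
    with (t - t * t ^ 2 / 6)%R by field.
  nra.
Qed.

Lemma pow2_tends_to_0_plus : tends_to_0_plus eventually (fun p => / INR (2 ^ p))%R.
Proof.
  intros d Hd. destruct (INR_unbounded (/ d)) as [N HN].
  exists N. intros p Hp.
  assert (HNp : (N <= 2 ^ p)%nat).
  { pose proof (Nat.pow_gt_lin_r 2 p). lia. }
  apply le_INR in HNp. pose proof (Rinv_0_lt_compat d Hd).
  split; [apply Rinv_0_lt_compat; lra|].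
  rewrite <- (Rinv_inv d). apply Rinv_lt_contravar; [nra | lra].
Qed.

Lemma clim_bounded {T : Type} (F : (T -> Prop) -> Prop) {FF : Filter F}
    (f : T -> C) (l : C) :
  clim F f l -> F (fun t => (Cmod (f t) <= Cmod l + 1)%R).
Proof.
  intros Hf. generalize (Hf 1%R Rlt_0_1). apply filter_imp. intros t Ht.
  replace (f t) with (l + (f t - l)) by ring.
  eapply Rle_trans; [apply Cmod_triangle|]. lra.
Qed.

(** The main part [1 - cos (PI * k * h)] is at least [k ^ 2 * h ^ 2 / 2], and the perturbation
    [Ccosh a - 1] costs at most [B * h ^ 2], hence at most half of that. *)
Lemma Ccosh_minus_cos_ge (a : C) (k h B : R) :
  (0 < h)%R -> (0 <= k)%R -> (k * h <= 1)%R -> (4 * B <= k ^ 2)%R ->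
  (Cmod ((Ccosh a - 1) / h ^ 2) <= B)%R ->
  (h ^ 2 * k ^ 2 / 4 <= Cmod (Ccosh a - cos (PI * k * h)))%R.
Proof.
  intros Hh Hk Hkh HB Ha.
  assert (Hh2 : (0 < h ^ 2)%R) by (apply pow_lt, Hh).
  rewrite Cmod_div in Ha by (apply Cpow_nz; intros E; apply RtoC_inj in E; lra).
  rewrite <- RtoC_pow, Cmod_R, Rabs_pos_eq in Ha by lra.
  apply Rle_div_l in Ha; [|exact Hh2].
  pose proof PI2_3_2.
  (* [sin_ge_third] gives a third of the angle, and [PI >= 3]. *)
  assert (Hs : (k * h / 2 <= sin (PI * k * h / 2))%R).
  { eapply Rle_trans; [|apply sin_ge_third].
    - assert (0 <= k * h)%R by nra. nra.
    - assert (0 <= k * h)%R by nra. nra. }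
  assert (Hc : (k ^ 2 * h ^ 2 / 2 <= 1 - cos (PI * k * h))%R).
  { replace (PI * k * h)%R with (2 * (PI * k * h / 2))%R by field.
    rewrite cos_2a_sin. assert (0 <= k * h / 2)%R by nra. nra. }
  replace (Ccosh a - cos (PI * k * h))
    with (RtoC (1 - cos (PI * k * h)) + (Ccosh a - 1))
    by (rewrite RtoC_minus; ring).
  eapply Rle_trans; [|apply Cmod_minus_ge].
  rewrite Cmod_R, Rabs_pos_eq by nra. nra.
Qed.

(** The finite identity [coth_pow2] at [a = w / 2 ^ p], divided by [2 ^ p], is passed to the limit
    in [p] under the sum by Tannery's theorem. *)
Lemma coth_expansion (w : C) :
  Csinh w <> 0 -> w <> 0 ->
  (forall k : nat, (1 <= k)%nat -> INR k ^ 2 + (w / PI) ^ 2 <> 0) ->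
  has_sum (fun k => 2 * w / (w ^ 2 + (PI * INR k) ^ 2)) (Ccoth w - 1 / w).
Proof.
  intros Hs Hw Hden.
  pose proof PI_RGT_0 as HPI.
  assert (HPIC : RtoC PI <> 0) by (intros E; apply RtoC_inj in E; lra).
  set (h := fun p => (/ INR (2 ^ p))%R).
  pose proof pow2_tends_to_0_plus as Hh. fold h in Hh.
  pose proof eventually_filter as FFp.
  assert (FF : Filter eventually) by apply FFp.
  assert (HM : forall p, (0 < INR (2 ^ p))%R).
  { intros p. apply lt_0_INR. pose proof (Nat.pow_gt_lin_r 2 p). lia. }
  assert (Hh0 : forall p, (0 < h p)%R).
  { intros p. apply Rinv_0_lt_compat, HM. }
  assert (HhC : forall p, RtoC (h p) <> 0).
  { intros p E. apply RtoC_inj in E. specialize (Hh0 p). lra. }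
  assert (HMh : forall p, INR (2 ^ p) * (h p * w) = w).
  { intros p. unfold h. rewrite RtoC_inv by (specialize (HM p); lra).
    field. intros E. apply RtoC_inj in E. specialize (HM p). lra. }
  assert (Hden' : forall k : nat, (1 <= k)%nat -> w ^ 2 + (PI * INR k) ^ 2 <> 0).
  { intros k Hk E. apply (Hden k Hk).
    replace (INR k ^ 2 + (w / PI) ^ 2) with ((w ^ 2 + (PI * INR k) ^ 2) / PI ^ 2)
      by (field; exact HPIC).
    rewrite E. unfold Cdiv. ring. }
  set (g := fun k : nat => 2 * w / (w ^ 2 + (PI * INR k) ^ 2)).
  assert (Hg : exists l, has_sum g l).
  { destruct (sqr_plus_lower_bound ((w / PI) ^ 2) Hden) as [c [d [Hc [Hd Hb]]]].
    apply (ex_has_sum_inv_sqr g (2 * Cmod w / (PI ^ 2 * c))%R).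
    intros k Hk. pose proof (INR_ge_1 k Hk) as Hk1.
    assert (H1 : (c * INR k ^ 2 <= Cmod (INR k ^ 2 + (w / PI) ^ 2))%R).
    { apply Hb; [|exact Hk]. replace (_ - _) with (RtoC 0) by ring.
      rewrite Cmod_0. exact Hd. }
    unfold g. rewrite Cmod_div by auto.
    replace (w ^ 2 + (PI * INR k) ^ 2) with (RtoC (PI ^ 2) * (INR k ^ 2 + (w / PI) ^ 2))
      by (rewrite RtoC_pow; field; exact HPIC).
    rewrite !Cmod_mult, !Cmod_R, !Rabs_pos_eq by (try apply pow_le; lra).
    assert (0 < c * INR k ^ 2)%R by (apply Rmult_lt_0_compat; [lra | apply pow_lt; lra]).
    assert (0 < PI ^ 2)%R by (apply pow_lt; lra).
    replace (2 * Cmod w / (PI ^ 2 * c) / INR k ^ 2)%R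
      with (2 * Cmod w / (PI ^ 2 * (c * INR k ^ 2)))%R by (field; lra).
    apply Rmult_le_compat_l; [pose proof (Cmod_ge_0 w); lra|].
    apply Rinv_le_contravar; [nra|]. apply Rmult_le_compat_l; lra. }
  destruct Hg as [l Hg].
  (* Extension by 0 from [k = 2 ^ p] on turns the finite sum into a series, as Tannery's theorem
     expects. *)
  set (f := fun p k => if Nat.ltb k (2 ^ p) then
    h p * (Csinh (h p * w) / (Ccosh (h p * w) - cos (PI * INR k * h p))) else 0).
  (* The second term tends to [1 / w], because [Csinh (h p * w) / h p] tends to [w] and the cosh to
     1. *)
  set (s := fun p => Ccoth w - h p * Ccoth (h p * w)).
  assert (Hf : forall p, has_sum (f p) (s p)).
  { intros p.
    destruct (coth_pow2 p (h p * w)) as [H1 [H2 H3]]; [rewrite HMh; exact Hs|].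
    rewrite HMh in H3.
    apply (eq_ind (csum (f p) (2 ^ p - 1)) (has_sum (f p))).
    - apply has_sum_finite. intros k Hk. unfold f.
      destruct (Nat.ltb_spec k (2 ^ p)); [lia|reflexivity].
    - unfold s.
      replace (Ccoth w) with (h p * (INR (2 ^ p) * Ccoth w)).
      2:{ unfold h. rewrite RtoC_inv by (specialize (HM p); lra).
          field. intros E. apply RtoC_inj in E. specialize (HM p). lra. }
      rewrite H3, Cmult_plus_distr_l, <- csum_scal.
      rewrite (csum_ext (f p) (fun k => h p * (Csinh (h p * w)
        / (Ccosh (h p * w) - cos (PI * INR k / INR (2 ^ p)))))); [ring|].
      intros k Hk. unfold f. destruct (Nat.ltb_spec k (2 ^ p)); [reflexivity|lia]. }
  assert (Hlim : l = Ccoth w - 1 / w).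
  { apply (clim_unique eventually s).
    (* [B] eventually bounds [(Ccosh (h p * w) - 1) / h p ^ 2], the case [s = 0] of
       [clim_Ccosh_minus_cos]; beyond [K0] one has [4 * B <= INR k ^ 2]. *)
    - set (B := (Cmod ((w ^ 2 + RtoC 0 ^ 2) / 2) + 1)%R).
      destruct (INR_unbounded (4 * B + 1)) as [K0 HK0].
      apply (tannery eventually f g
        (fun k => 4 * (Cmod w + 1) * (harmonic k / INR k ^ 2))%R K0 s l).
      + apply summable_scal, summable_harmonic.
      + pose proof (clim_bounded _ _ _ (clim_Csinh_quotient eventually h w Hh)) as H1.
        pose proof (clim_bounded _ _ _ (clim_Ccosh_minus_cos eventually h w 0 Hh)) as H2.
        generalize (filter_and _ _ H1 H2). apply filter_imp.
        intros p [H3 H4] k Hk. fold B in H4.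
        apply lt_INR in Hk as Hk'.
        pose proof (Cmod_ge_0 ((w ^ 2 + RtoC 0 ^ 2) / 2)) as HB1.
        pose proof (Cmod_ge_0 w) as Hw0.
        assert (Hk1 : (1 < INR k)%R) by (unfold B in *; lra).
        assert (Hk1' : (1 <= k)%nat) by lia.
        assert (HH : (0 < / INR k ^ 2)%R) by (apply Rinv_0_lt_compat, pow_lt; lra).
        pose proof (harmonic_ge_1 k Hk1') as Hhar.
        unfold f. destruct (Nat.ltb_spec k (2 ^ p)) as [Hlt|_].
        * assert (Hge : (h p ^ 2 * INR k ^ 2 / 4
            <= Cmod (Ccosh (h p * w) - cos (PI * INR k * h p)))%R).
          { apply Ccosh_minus_cos_ge with (B := B).
            - apply Hh0.
            - lra.
            - apply Rmult_le_reg_r with (INR (2 ^ p)); [apply HM|].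
              unfold h. rewrite Rmult_assoc, Rinv_l by (specialize (HM p); lra).
              apply lt_INR in Hlt. lra.
            - nra.
            - rewrite Rmult_0_l, cos_0 in H4. exact H4. }
          assert (Hpos : (0 < h p ^ 2 * INR k ^ 2 / 4)%R).
          { assert (0 < h p ^ 2)%R by apply pow_lt, Hh0.
            assert (0 < INR k ^ 2)%R by (apply pow_lt; lra). nra. }
          rewrite Cmod_div in H3 by apply HhC.
          rewrite Cmod_mult, Cmod_div by (apply Cmod_gt_0; lra).
          rewrite Cmod_R, Rabs_pos_eq in * by (left; apply Hh0).
          apply Rle_div_l in H3; [|apply Hh0].
          (* The powers of [h p] cancel, leaving a bound [4 * (Cmod w + 1) / INR k ^ 2] independent
             of [p]. *)
          apply Rle_trans with (h p * ((Cmod w + 1) * h p / (h p ^ 2 * INR k ^ 2 / 4)))%R.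
          -- apply Rmult_le_compat_l; [left; apply Hh0|].
             apply Rmult_le_compat; [apply Cmod_ge_0 | | exact H3 |].
             ++ left. apply Rinv_0_lt_compat. lra.
             ++ apply Rinv_le_contravar; lra.
          -- replace (h p * ((Cmod w + 1) * h p / (h p ^ 2 * INR k ^ 2 / 4)))%R
               with (4 * (Cmod w + 1) * (1 / INR k ^ 2))%R
               by (specialize (Hh0 p); field; lra).
             apply Rmult_le_compat_l; [lra|].
             apply Rmult_le_compat_r; lra.
        * rewrite Cmod_0. apply Rmult_le_pos; [lra|].
          apply Rmult_le_pos; lra.
      + intros k Hk.
        apply clim_ext with (fun p => (Csinh (h p * w) / h p)
          / ((Ccosh (h p * w) - cos (PI * INR k * h p)) / h p ^ 2)); [exact FF| |].
        (* For [p >= k] one has [k < 2 ^ p], so the cut-off is inactive. *)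
        * exists k. intros p Hp. unfold f.
          destruct (Nat.ltb_spec k (2 ^ p)) as [Hlt|Hge].
          2:{ pose proof (Nat.pow_gt_lin_r 2 p). lia. }
          destruct (coth_pow2 p (h p * w)) as [_ [H2 _]]; [rewrite HMh; exact Hs|].
          assert (H3 := H2 k (conj Hk Hlt)).
          field. split; [exact H3 | apply HhC].
        * unfold g.
          replace (2 * w / (w ^ 2 + (PI * INR k) ^ 2))
            with (w / ((w ^ 2 + RtoC (PI * INR k) ^ 2) / 2))
            by (rewrite RtoC_mult; field; auto).
          apply clim_div; [exact FF | | apply clim_Csinh_quotient; assumption
            | apply clim_Ccosh_minus_cos; assumption].
          rewrite RtoC_mult. intros E. apply (Hden' k Hk).
          replace (w ^ 2 + (PI * INR k) ^ 2)
            with (2 * ((w ^ 2 + (PI * INR k) ^ 2) / 2)) by field.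
          rewrite E. ring.
      + apply filter_forall. exact Hf.
      + exact Hg.
    - unfold s. apply clim_minus; [exact FF | apply clim_const, FF |].
      apply clim_ext with (fun p => Ccosh (h p * w) / (Csinh (h p * w) / h p));
        [exact FF | |].
      + apply filter_forall. intros p.
        destruct (coth_pow2 p (h p * w)) as [H1 _]; [rewrite HMh; exact Hs|].
        unfold Ccoth. field. split; [exact H1 | apply HhC].
      + apply clim_div; [exact FF | exact Hw | apply clim_Ccosh; assumption
          | apply clim_Csinh_quotient; assumption]. }
  rewrite <- Hlim. exact Hg.
Qed.

Definition nonvanishing (y : C) : Prop :=
  forall n : nat, (1 <= n)%nat -> INR n ^ 2 + y ^ 2 <> 0.

Lemma not_negative_integer_nonvanishing (z : C) :
  ~ negative_integer (z ^ 2) -> nonvanishing z.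
Proof.
  intros Hz k Hk E. apply Hz. exists (- Z.of_nat (k * k))%Z. split; [lia|].
  rewrite opp_IZR, <- INR_IZR_INZ, mult_INR, RtoC_opp, RtoC_mult.
  replace (z ^ 2) with (INR k ^ 2 + z ^ 2 - INR k * INR k) by ring.
  rewrite E. ring.
Qed.

Lemma pi_coth_expansion (z : C) :
  ~ negative_integer (z ^ 2) ->
  has_sum (fun k => 2 * z ^ 2 / (INR k ^ 2 + z ^ 2)) (pi_coth z - 1).
Proof.
  intros Hz. unfold pi_coth. destruct (Ceq_dec z 0) as [->|Hz0].
  - apply (has_sum_ext (fun _ => 0)).
    + intros k Hk. unfold Cdiv. ring.
    + replace (1 - 1) with (RtoC 0) by ring. apply has_sum_0.
  - pose proof PI_RGT_0 as HPI.
    assert (HPIC : RtoC PI <> 0) by (intros E; apply RtoC_inj in E; lra).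
    pose proof (not_negative_integer_nonvanishing z Hz) as Hk.
    apply (has_sum_ext (fun k => PI * z * (2 * (PI * z)
      / ((PI * z) ^ 2 + (PI * INR k) ^ 2)))).
    + intros k Hk1. specialize (Hk k Hk1).
      replace ((PI * z) ^ 2 + (PI * INR k) ^ 2) with (PI ^ 2 * (INR k ^ 2 + z ^ 2))
        by ring.
      field. auto.
    + replace (PI * z * Ccoth (PI * z) - 1)
        with (PI * z * (Ccoth (PI * z) - 1 / (PI * z))) by (field; auto).
      apply has_sum_scal, coth_expansion.
      (* A zero of sinh at [PI * z] would give [z = Ci * j], so [z ^ 2] would be the negative
         integer [- j ^ 2], as [z] is not 0. *)
      * intros E. destruct (Csinh_eq_0 _ E) as [j Hj].
        assert (Hzj : z = Ci * IZR j).
        { replace z with ((PI * z) / PI) by (field; exact HPIC).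
          rewrite Hj, RtoC_mult. field. exact HPIC. }
        apply Hz. exists (- (j * j))%Z. split.
        -- assert (j <> 0)%Z; [|nia]. intros ->. apply Hz0. rewrite Hzj. ring.
        -- rewrite Hzj, opp_IZR, mult_IZR. Ccomp; ring.
      * apply Cmult_neq_0; assumption.
      * intros k Hk1. replace (PI * z / PI) with z by (field; exact HPIC).
        apply Hk, Hk1.
Qed.

(** * The kernels and the identity for fixed n *)

Definition odd_kernel (y : C) (r : R) : C := r / (r ^ 2 + y ^ 2).
(** For [y <> 0] the value 1 at [r = 0] agrees with the formula; at [y = 0] it keeps the sum over
    all integers equal to [pi_coth y]. *)
Definition even_kernel (y : C) (r : R) : C :=
  if Req_dec_T r 0 then 1 else y ^ 2 / (r ^ 2 + y ^ 2).

Lemma odd_kernel_0 (y : C) : odd_kernel y 0 = 0.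
Proof. unfold odd_kernel, Cdiv. ring. Qed.

Lemma odd_kernel_opp (y : C) (r : R) : odd_kernel y (- r) = - odd_kernel y r.
Proof.
  unfold odd_kernel, Cdiv. rewrite RtoC_opp.
  replace ((- r) ^ 2 + y ^ 2) with (r ^ 2 + y ^ 2) by ring. ring.
Qed.

Lemma even_kernel_0 (y : C) : even_kernel y 0 = 1.
Proof. unfold even_kernel. destruct (Req_dec_T 0 0); [reflexivity|lra]. Qed.

Lemma even_kernel_opp (y : C) (r : R) : even_kernel y (- r) = even_kernel y r.
Proof.
  unfold even_kernel. rewrite RtoC_opp.
  replace ((- r) ^ 2 + y ^ 2) with (r ^ 2 + y ^ 2) by ring.
  destruct (Req_dec_T (- r) 0), (Req_dec_T r 0); [reflexivity|lra|lra|reflexivity].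
Qed.

(* The second difference [h(n + ix) - 2 h(n) + h(n - ix)] of [h = odd_kernel y],
   divided by [-2 x^2]. *)
Definition rhs_term (x y : C) (n : nat) : C :=
  INR n * (INR n ^ 2 + x ^ 2 - 3 * y ^ 2) / ((INR n ^ 2 + y ^ 2) * den x y n).

Lemma sub_sqr_plus_nonzero (y : C) (n k : nat) :
  nonvanishing y -> (n <> k)%nat ->
  (INR n - INR k) ^ 2 + y ^ 2 <> 0.
Proof.
  intros Hy Hnk. destruct (Nat.lt_total n k) as [H|[H|H]]; [|lia|].
  - specialize (Hy (k - n)%nat). rewrite minus_INR, RtoC_minus in Hy by lia.
    replace ((INR n - INR k) ^ 2) with ((INR k - INR n) ^ 2) by ring. apply Hy. lia.
  - specialize (Hy (n - k)%nat). rewrite minus_INR, RtoC_minus in Hy by lia.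
    apply Hy. lia.
Qed.

(** The coefficient of [1 / (k ^ 2 + x ^ 2)] is found by setting [k ^ 2 = - x ^ 2], where the
    product of [(n + k) ^ 2 + y ^ 2] and [(n - k) ^ 2 + y ^ 2] becomes [den x y n]; this is where
    that denominator comes from. *)
Lemma partial_fraction_identity (x y : C) (n k : nat) :
  (1 <= n)%nat -> (1 <= k)%nat ->
  nonvanishing x -> nonvanishing y -> den x y n <> 0 ->
  - (odd_kernel y (INR n + INR k) + odd_kernel y (INR n - INR k)
     - 2 * odd_kernel y (INR n)) / (INR k ^ 2 + x ^ 2)
  = / den x y n *
      ((y ^ 2 - x ^ 2 - INR n ^ 2)
         * (odd_kernel y (INR n + INR k) + odd_kernel y (INR n - INR k))
       + 2 * INR n
         * (even_kernel y (INR n + INR k) + even_kernel y (INR n - INR k)))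
    + rhs_term x y n * (2 * x ^ 2 / (INR k ^ 2 + x ^ 2)).
Proof.
  intros Hn Hk Hx Hy Hd.
  pose proof (INR_ge_1 n Hn) as Hn1. pose proof (INR_ge_1 k Hk) as Hk1.
  assert (H1 : INR k ^ 2 + x ^ 2 <> 0) by (apply Hx, Hk).
  assert (H2 : INR n ^ 2 + y ^ 2 <> 0) by (apply Hy, Hn).
  assert (H3 : (INR n + INR k) ^ 2 + y ^ 2 <> 0).
  { rewrite <- RtoC_plus, <- plus_INR. apply Hy. lia. }
  assert (Hnk : RtoC (INR n + INR k) = INR n + INR k) by apply RtoC_plus.
  unfold rhs_term, even_kernel at 1.
  destruct (Req_dec_T (INR n + INR k) 0) as [E|_]; [lra|].
  (* For [n = k] the kernels at 0 take the values 0 and 1, also when [y = 0] and the fractions would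
     read 0 / 0. *)
  destruct (Nat.eq_dec n k) as [->|Hne].
  - replace (INR k - INR k)%R with 0%R by ring.
    rewrite odd_kernel_0, even_kernel_0. unfold odd_kernel, den in *. rewrite Hnk in *.
    field. auto.
  - unfold even_kernel. destruct (Req_dec_T (INR n - INR k) 0) as [E|_].
    { exfalso. apply Hne, INR_eq. lra. }
    pose proof (sub_sqr_plus_nonzero y n k Hy Hne) as H4.
    unfold odd_kernel, den in *. rewrite Hnk, RtoC_minus in *.
    field. auto.
Qed.

(** * Sums of the kernels over all integers, by telescoping *)

Definition vanishing_at_infinity (f : R -> C) : Prop :=
  forall c : R, clim eventually (fun N => f (INR N + c)%R) 0.

Lemma vanishing_of_bound (f : R -> C) (a b : R) :
  (forall r : R, (b < r)%R -> (Cmod (f r) <= a / r)%R) -> vanishing_at_infinity f.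
Proof.
  intros Hf c eps He.
  destruct (INR_unbounded (Rabs b + Rabs a / eps - c)) as [N HN].
  exists N. intros n Hn. apply le_INR in Hn.
  pose proof (Rle_abs b) as Hb. pose proof (Rabs_pos b) as Hb0.
  pose proof (Rabs_pos a) as Ha0. pose proof (Rle_abs a) as Ha.
  assert (0 <= Rabs a / eps)%R by (apply Rdiv_le_0_compat; lra).
  replace (f (INR n + c)%R - 0) with (f (INR n + c)%R) by ring.
  eapply Rle_lt_trans; [apply Hf; lra|].
  apply Rlt_div_l; [lra|].
  assert (Rabs a / eps < INR n + c)%R as H1 by lra.
  apply Rlt_div_l in H1; [|exact He]. lra.
Qed.

Lemma real_sqr_plus_ge (y : C) (r : R) :
  (2 * Cmod y + 1 < r)%R -> (r ^ 2 / 2 <= Cmod (r ^ 2 + y ^ 2))%R.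
Proof.
  intros Hr. pose proof (Cmod_ge_0 y) as Hy.
  eapply Rle_trans; [|apply Cmod_minus_ge].
  rewrite !Cmod_pow, Cmod_R, Rabs_pos_eq by lra. nra.
Qed.

Lemma odd_kernel_vanishing (y : C) : vanishing_at_infinity (odd_kernel y).
Proof.
  apply vanishing_of_bound with 2%R (2 * Cmod y + 1)%R. intros r Hr.
  pose proof (real_sqr_plus_ge y r Hr) as H. pose proof (Cmod_ge_0 y) as Hy.
  assert (0 < r ^ 2)%R by (apply pow_lt; lra).
  unfold odd_kernel. rewrite Cmod_div by (apply Cmod_gt_0; lra).
  rewrite Cmod_R, Rabs_pos_eq by lra.
  apply Rle_div_l; [lra|].
  replace r with (2 / r * (r ^ 2 / 2))%R at 1 by (field; lra).
  apply Rmult_le_compat_l; [|exact H]. apply Rdiv_le_0_compat; lra.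
Qed.

Lemma even_kernel_vanishing (y : C) : vanishing_at_infinity (even_kernel y).
Proof.
  apply vanishing_of_bound with (2 * Cmod y ^ 2)%R (2 * Cmod y + 1)%R. intros r Hr.
  pose proof (real_sqr_plus_ge y r Hr) as H. pose proof (Cmod_ge_0 y) as Hy.
  assert (0 < r ^ 2)%R by (apply pow_lt; lra).
  unfold even_kernel. destruct (Req_dec_T r 0) as [E|_]; [lra|].
  rewrite Cmod_div by (apply Cmod_gt_0; lra). rewrite Cmod_pow.
  apply Rle_div_l; [lra|].
  apply Rle_trans with (2 * Cmod y ^ 2 / r * (r ^ 2 / 2))%R.
  - replace (2 * Cmod y ^ 2 / r * (r ^ 2 / 2))%R with (Cmod y ^ 2 * r)%R by (field; lra).
    rewrite <- (Rmult_1_r (Cmod y ^ 2)) at 1.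
    apply Rmult_le_compat_l; [apply pow_le, Hy | lra].
  - apply Rmult_le_compat_l; [|exact H].
    apply Rdiv_le_0_compat; [|lra].
    apply Rmult_le_pos; [lra | apply pow_le, Hy].
Qed.

Lemma csum_telescope (f : R -> C) (a : R) (N : nat) :
  csum (fun k => f (INR k + (a + 1))%R - f (INR k + a)%R) N
  = f (INR N + (a + 1))%R - f (1 + a)%R.
Proof.
  induction N as [|N IH].
  - simpl. replace (0 + (a + 1))%R with (1 + a)%R by ring. ring.
  - rewrite csum_S, IH, S_INR.
    replace (INR N + 1 + a)%R with (INR N + (a + 1))%R by ring. ring.
Qed.

Lemma has_sum_telescope (f : R -> C) (a : R) :
  vanishing_at_infinity f ->
  has_sum (fun k => f (INR k + (a + 1))%R - f (INR k + a)%R) (- f (1 + a)%R).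
Proof.
  intros Hf. pose proof eventually_filter as FFp.
  assert (FF : Filter eventually) by apply FFp.
  apply clim_ext with (fun N => f (INR N + (a + 1))%R - f (1 + a)%R); [exact FF| |].
  - apply filter_forall. intros N. symmetry. apply csum_telescope.
  - apply (eq_ind (0 - f (1 + a)%R) (clim eventually _)); [|ring].
    apply clim_minus; [exact FF | apply Hf | apply clim_const, FF].
Qed.

(** The sum over all integers, taken symmetrically about [n], is 0. At [n = 0] the terms cancel by
    oddness; moving the centre to [n + 1] adds one telescoping series at each end. *)
Lemma has_sum_odd_kernel (y : C) (n : nat) :
  has_sum (fun k => odd_kernel y (INR n + INR k) + odd_kernel y (INR n - INR k))
    (- odd_kernel y (INR n)).
Proof.
  pose proof (odd_kernel_vanishing y) as Hv.
  induction n as [|n IH].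
  - apply (has_sum_ext (fun _ => 0)).
    + intros k _. simpl. replace (0 - INR k)%R with (- (0 + INR k))%R by ring.
      rewrite odd_kernel_opp. ring.
    + simpl. rewrite odd_kernel_0. replace (- 0) with (RtoC 0) by ring.
      apply has_sum_0.
  - pose proof (has_sum_plus _ _ _ _ (has_sum_plus _ _ _ _ IH
      (has_sum_telescope _ (INR n) Hv)) (has_sum_telescope _ (- (INR n + 1)) Hv)) as H.
    replace (- odd_kernel y (INR n) + - odd_kernel y (1 + INR n)
      + - odd_kernel y (1 + - (INR n + 1))) with (- odd_kernel y (INR (S n))) in H.
    + revert H. apply has_sum_ext. intros k _.
      replace (INR k + (- (INR n + 1) + 1))%R with (- (INR n - INR k))%R by ring.
      replace (INR k + - (INR n + 1))%R with (- (INR (S n) - INR k))%R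
        by (rewrite S_INR; ring).
      replace (INR k + (INR n + 1))%R with (INR (S n) + INR k)%R
        by (rewrite S_INR; ring).
      replace (INR k + INR n)%R with (INR n + INR k)%R by ring.
      rewrite !odd_kernel_opp. ring.
    + replace (1 + - (INR n + 1))%R with (- INR n)%R by ring.
      rewrite odd_kernel_opp, S_INR, (Rplus_comm 1). ring.
Qed.

(** The same recentring, started from the coth expansion at [n = 0]; evenness reverses the sign of
    the second telescoping series. *)
Lemma has_sum_even_kernel (y : C) (n : nat) :
  ~ negative_integer (y ^ 2) ->
  has_sum (fun k => even_kernel y (INR n + INR k) + even_kernel y (INR n - INR k))
    (pi_coth y - even_kernel y (INR n)).
Proof.
  intros Hy. pose proof (even_kernel_vanishing y) as Hv.
  induction n as [|n IH].
  - simpl. rewrite even_kernel_0. generalize (pi_coth_expansion y Hy).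
    apply has_sum_ext. intros k Hk. pose proof (INR_ge_1 k Hk) as Hk1.
    replace (0 - INR k)%R with (- (0 + INR k))%R by ring.
    rewrite even_kernel_opp, Rplus_0_l.
    unfold even_kernel. destruct (Req_dec_T (INR k) 0) as [E|_]; [lra|].
    unfold Cdiv. ring.
  - pose proof (has_sum_plus _ _ _ _ (has_sum_plus _ _ _ _ IH
      (has_sum_telescope _ (INR n) Hv))
      (has_sum_scal (- (1)) _ _ (has_sum_telescope _ (- (INR n + 1)) Hv))) as H.
    replace (pi_coth y - even_kernel y (INR n) + - even_kernel y (1 + INR n)
      + - (1) * - even_kernel y (1 + - (INR n + 1)))
      with (pi_coth y - even_kernel y (INR (S n))) in H.
    + revert H. apply has_sum_ext. intros k _.
      replace (INR k + (- (INR n + 1) + 1))%R with (- (INR n - INR k))%R by ring.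
      replace (INR k + - (INR n + 1))%R with (- (INR (S n) - INR k))%R
        by (rewrite S_INR; ring).
      replace (INR k + (INR n + 1))%R with (INR (S n) + INR k)%R
        by (rewrite S_INR; ring).
      replace (INR k + INR n)%R with (INR n + INR k)%R by ring.
      rewrite !even_kernel_opp. ring.
    + replace (1 + - (INR n + 1))%R with (- INR n)%R by ring.
      rewrite even_kernel_opp, S_INR, (Rplus_comm 1). ring.
Qed.

(** * Second differences: their sums over the step and over the centre, with bounds *)

Definition second_difference (y : C) (k n : nat) : C :=
  odd_kernel y (INR n + INR k) + odd_kernel y (INR n - INR k)
  - 2 * odd_kernel y (INR n).

Lemma has_sum_second_difference (x y : C) (n : nat) :
  (1 <= n)%nat -> admissible x y -> den x y n <> 0 ->
  has_sum (fun k => - second_difference y k n / (INR k ^ 2 + x ^ 2))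
    (pi_coth x * rhs_term x y n + 2 * pi_coth y * rhs_term2 x y n).
Proof.
  intros Hn [Hx Hy] Hd. pose proof (INR_ge_1 n Hn) as Hn1.
  pose proof (not_negative_integer_nonvanishing x Hx) as Hx'.
  pose proof (not_negative_integer_nonvanishing y Hy) as Hy'.
  assert (H2 : INR n ^ 2 + y ^ 2 <> 0) by (apply Hy', Hn).
  pose proof (has_sum_plus _ _ _ _
    (has_sum_scal (/ den x y n) _ _ (has_sum_plus _ _ _ _
      (has_sum_scal (y ^ 2 - x ^ 2 - INR n ^ 2) _ _ (has_sum_odd_kernel y n))
      (has_sum_scal (2 * INR n) _ _ (has_sum_even_kernel y n Hy))))
    (has_sum_scal (rhs_term x y n) _ _ (pi_coth_expansion x Hx))) as H.
  match type of H with has_sum _ ?l =>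
    replace l with (pi_coth x * rhs_term x y n + 2 * pi_coth y * rhs_term2 x y n) in H
  end.
  - revert H. apply has_sum_ext. intros k Hk. symmetry.
    apply partial_fraction_identity; assumption.
  (* The contributions of the central values of the two kernels at [n] add up to [rhs_term x y n],
     which cancels the [-1] of [pi_coth x - 1]. *)
  - unfold rhs_term, rhs_term2, odd_kernel, even_kernel.
    destruct (Req_dec_T (INR n) 0) as [E|_]; [lra|]. field. auto.
Qed.

(* The coefficient of [1 / (k^2 + x^2)] in [lhs_term x y k]. *)
Definition lhs_coef (y : C) (k : nat) : C :=
  csum (fun m => 2 * odd_kernel y (INR m)) k - odd_kernel y (INR k).

Lemma lhs_term_coef (x y : C) (n : nat) :
  (1 <= n)%nat -> lhs_term x y n = lhs_coef y n / (INR n ^ 2 + x ^ 2).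
Proof.
  intros Hn. unfold lhs_term, lhs_coef. rewrite csum_sum_n_m.
  destruct n as [|n]; [lia|]. replace (S n - 1)%nat with n by lia.
  rewrite csum_S.
  rewrite (csum_ext (fun m => 2 * odd_kernel y (INR m))
    (fun m => 2 * INR m / (INR m ^ 2 + y ^ 2))).
  - unfold odd_kernel, Cdiv. ring.
  - intros m _. unfold odd_kernel, Cdiv. ring.
Qed.

(** Raising [k] by one changes the summand by two first differences in [n], which telescope and
    leave four kernel values. This recursion yields both the limit as [L] grows and a bound uniform
    in [L]. *)
Lemma csum_second_difference_S (y : C) (k L : nat) :
  csum (second_difference y (S k)) L = csum (second_difference y k) L
    + (odd_kernel y (INR L + INR (S k)) - odd_kernel y (INR (S k)))
    - (odd_kernel y (INR L - INR k) + odd_kernel y (INR k)).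
Proof.
  pose proof (csum_telescope (odd_kernel y) (INR k) L) as H1.
  pose proof (csum_telescope (odd_kernel y) (- (INR k + 1)) L) as H2.
  replace (1 + INR k)%R with (INR (S k)) in H1 by (rewrite S_INR; ring).
  replace (INR L + (INR k + 1))%R with (INR L + INR (S k))%R in H1
    by (rewrite S_INR; ring).
  replace (1 + - (INR k + 1))%R with (- INR k)%R in H2 by ring.
  replace (INR L + (- (INR k + 1) + 1))%R with (INR L - INR k)%R in H2 by ring.
  rewrite odd_kernel_opp in H2.
  replace (odd_kernel y (INR L - INR k) + odd_kernel y (INR k))
    with (odd_kernel y (INR L - INR k) - - odd_kernel y (INR k)) by ring.
  rewrite <- H1, <- H2.
  match goal with |- _ = _ + csum ?u _ - csum ?v _ =>
    transitivity (csum (second_difference y k) L + csum u L + - (1) * csum v L)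
  end; [|ring].
  rewrite <- csum_scal, <- !csum_plus. apply csum_ext. intros n _.
  unfold second_difference.
  replace (INR n + (- (INR k + 1) + 1))%R with (INR n - INR k)%R by ring.
  replace (INR n + - (INR k + 1))%R with (INR n - INR (S k))%R
    by (rewrite S_INR; ring).
  replace (INR n + (INR k + 1))%R with (INR n + INR (S k))%R
    by (rewrite S_INR; ring).
  ring.
Qed.

Lemma second_difference_0 (y : C) (n : nat) : second_difference y 0 n = 0.
Proof.
  unfold second_difference. simpl. rewrite Rplus_0_r, Rminus_0_r. ring.
Qed.

Lemma lhs_coef_S (y : C) (k : nat) :
  lhs_coef y (S k) = lhs_coef y k + odd_kernel y (INR k) + odd_kernel y (INR (S k)).
Proof. unfold lhs_coef. rewrite csum_S. ring. Qed.

Lemma has_sum_lhs_coef (y : C) (k : nat) :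
  has_sum (second_difference y k) (- lhs_coef y k).
Proof.
  pose proof eventually_filter as FFp.
  assert (FF : Filter eventually) by apply FFp.
  pose proof (odd_kernel_vanishing y) as Hv.
  induction k as [|k IH].
  - apply (has_sum_ext (fun _ => 0)).
    + intros n _. symmetry. apply second_difference_0.
    + unfold lhs_coef. simpl. rewrite odd_kernel_0.
      replace (- (0 - 0)) with (RtoC 0) by ring. apply has_sum_0.
  - apply clim_ext with (fun L => csum (second_difference y k) L
      + (odd_kernel y (INR L + INR (S k)) - odd_kernel y (INR (S k)))
      - (odd_kernel y (INR L - INR k) + odd_kernel y (INR k))); [exact FF| |].
    + apply filter_forall. intros L. symmetry. apply csum_second_difference_S.
    (* The values at [L + k + 1] and [L - k] vanish in the limit; the two fixed ones are the
       increment in [lhs_coef_S]. *)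
    + apply (eq_ind (- lhs_coef y k + (0 - odd_kernel y (INR (S k)))
        - (0 + odd_kernel y (INR k))) (clim eventually _)).
      2:{ rewrite lhs_coef_S. ring. }
      apply clim_minus; [exact FF | |].
      * apply clim_plus; [exact FF | exact IH |].
        apply clim_minus; [exact FF | apply Hv | apply clim_const, FF].
      * apply clim_plus; [exact FF | apply (Hv (- INR k)%R) | apply clim_const, FF].
Qed.

(* [1 / |L - j|] summed over [j < k]; the term [j = L] is [/ 0 = 0]. *)
Fixpoint window (L k : nat) : R :=
  match k with O => 0%R | S p => (window L p + / Rabs (INR L - INR p))%R end.

Lemma window_S (L k : nat) :
  window L (S k) = (window L k + / Rabs (INR L - INR k))%R.
Proof. reflexivity. Qed.

Lemma window_shift (L k : nat) :
  window (S L) (S k) = (/ INR (S L) + window L k)%R.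
Proof.
  induction k as [|k IH].
  - rewrite window_S. simpl (window _ 0). simpl (INR 0).
    rewrite Rminus_0_r, Rabs_pos_eq by apply pos_INR. ring.
  - rewrite window_S, IH, window_S.
    replace (INR (S L) - INR (S k))%R with (INR L - INR k)%R
      by (rewrite !S_INR; ring). ring.
Qed.

Lemma window_0 (k : nat) : window 0 (S k) = harmonic k.
Proof.
  induction k as [|k IH].
  - simpl. rewrite Rminus_0_r, Rabs_R0, Rinv_0. ring.
  - rewrite window_S, IH, harmonic_S. f_equal. f_equal.
    replace (INR 0) with 0%R by reflexivity.
    rewrite Rminus_0_l, Rabs_Ropp. apply Rabs_pos_eq, pos_INR.
Qed.

(** The points on either side of [L] each contribute at most a harmonic number. The [min] carries
    the induction that lowers [L] and [k] together: for [k > L] the second harmonic number grows by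
    exactly [/ INR (S L)]. *)
Lemma window_le_min (L k : nat) :
  (window L k <= harmonic k + harmonic (Nat.min k L))%R.
Proof.
  revert L. induction k as [|k IH]; intros L.
  - simpl. lra.
  - destruct L as [|L].
    + rewrite Nat.min_0_r, window_0. simpl (harmonic 0).
      pose proof (harmonic_incr k (S k)). rewrite Rplus_0_r. apply H. lia.
    + rewrite window_shift. simpl Nat.min. specialize (IH L).
      destruct (Nat.le_gt_cases k L) as [H|H].
      * rewrite Nat.min_l in * by exact H. rewrite !harmonic_S.
        assert (/ INR (S L) <= / INR (S k))%R.
        { apply Rinv_le_contravar; [apply lt_0_INR; lia | apply le_INR; lia]. }
        assert (0 < / INR (S k))%R by (apply Rinv_0_lt_compat, lt_0_INR; lia).
        lra.
      * rewrite Nat.min_r in * by lia. rewrite !harmonic_S.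
        assert (0 < / INR (S k))%R by (apply Rinv_0_lt_compat, lt_0_INR; lia).
        lra.
Qed.

Lemma window_le (L k : nat) : (window L k <= 2 * harmonic k)%R.
Proof.
  eapply Rle_trans; [apply window_le_min|].
  pose proof (harmonic_incr (Nat.min k L) k (Nat.le_min_l k L)). lra.
Qed.

Definition kernel_bound (y : C) (c : R) : Prop :=
  (0 <= c)%R /\
  forall j : nat, (1 <= j)%nat -> (Cmod (odd_kernel y (INR j)) <= c / INR j)%R.

Lemma odd_kernel_diff_bound (y : C) (c : R) (L k : nat) :
  kernel_bound y c ->
  (Cmod (odd_kernel y (INR L - INR k)) <= c * / Rabs (INR L - INR k))%R.
Proof.
  intros [Hc Hb]. destruct (Nat.lt_total L k) as [H|[->|H]].
  - replace (INR L - INR k)%R with (- INR (k - L))%R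
      by (rewrite minus_INR by lia; ring).
    rewrite odd_kernel_opp, Cmod_opp, Rabs_Ropp, Rabs_pos_eq by apply pos_INR.
    apply Hb. lia.
  - replace (INR k - INR k)%R with 0%R by ring.
    rewrite odd_kernel_0, Cmod_0, Rabs_R0, Rinv_0. lra.
  - replace (INR L - INR k)%R with (INR (L - k))%R by (rewrite minus_INR by lia; ring).
    rewrite Rabs_pos_eq by apply pos_INR. apply Hb. lia.
Qed.

(** Each step of the recursion in [k] costs at most [4 * c / (k + 1)], from the values at
    [L + k + 1], [k + 1] and [k], and [c / |L - k|], which [window] collects. The total is uniform
    in [L], as Tannery's theorem requires. *)
Lemma csum_second_difference_bound (y : C) (c : R) (L k : nat) :
  kernel_bound y c ->
  (Cmod (csum (second_difference y k) L) <= 6 * c * harmonic k)%R.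
Proof.
  intros Hb. pose proof Hb as [Hc Hb1].
  assert (H : (Cmod (csum (second_difference y k) L)
    <= c * (4 * harmonic k + window L k))%R).
  { induction k as [|k IH].
    - rewrite (csum_ext _ (fun _ => 0 * 0)).
      + rewrite csum_scal, Cmult_0_l, Cmod_0. simpl. lra.
      + intros n _. rewrite second_difference_0. ring.
    - rewrite csum_second_difference_S, harmonic_S, window_S.
      assert (H0 : (0 < / INR (S k))%R) by (apply Rinv_0_lt_compat, lt_0_INR; lia).
      assert (H1 : (Cmod (odd_kernel y (INR L + INR (S k))) <= c * / INR (S k))%R).
      { rewrite <- plus_INR. eapply Rle_trans; [apply Hb1; lia|].
        apply Rmult_le_compat_l; [exact Hc|].
        apply Rinv_le_contravar; [apply lt_0_INR; lia | apply le_INR; lia]. }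
      assert (H2 : (Cmod (odd_kernel y (INR (S k))) <= c * / INR (S k))%R)
        by (apply Hb1; lia).
      assert (H3 : (Cmod (odd_kernel y (INR L - INR k))
        <= c * / Rabs (INR L - INR k))%R) by (apply odd_kernel_diff_bound, Hb).
      (* [c / k <= 2 * c / (k + 1)] for [k >= 1], and the kernel is 0 at [k = 0]. *)
      assert (H4 : (Cmod (odd_kernel y (INR k)) <= c * (2 * / INR (S k)))%R).
      { destruct k as [|k].
        - simpl (INR 0). rewrite odd_kernel_0, Cmod_0.
          apply Rmult_le_pos; lra.
        - eapply Rle_trans; [apply Hb1; lia|].
          apply Rmult_le_compat_l; [exact Hc|].
          assert (1 <= INR (S k))%R by (apply INR_ge_1; lia).
          rewrite (S_INR (S k)). set (t := INR (S k)) in *.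
          apply Rmult_le_reg_l with (t * (t + 1))%R; [nra|].
          replace (t * (t + 1) * / t)%R with (t + 1)%R by (field; lra).
          replace (t * (t + 1) * (2 * / (t + 1)))%R with (2 * t)%R by (field; lra).
          lra. }
      unfold Cminus.
      eapply Rle_trans; [apply Cmod_triangle|]. rewrite Cmod_opp.
      eapply Rle_trans; [apply Rplus_le_compat; apply Cmod_triangle|].
      eapply Rle_trans;
        [apply Rplus_le_compat_r, Rplus_le_compat_l, Cmod_triangle|].
      rewrite Cmod_opp. fold (Rminus (INR L) (INR k)). lra. }
  eapply Rle_trans; [exact H|]. pose proof (window_le L k). nra.
Qed.

Lemma lhs_coef_bound (y : C) (c : R) (k : nat) :
  kernel_bound y c -> (Cmod (lhs_coef y k) <= 6 * c * harmonic k)%R.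
Proof.
  intros Hb. rewrite <- Cmod_opp.
  replace (- lhs_coef y k) with (- lhs_coef y k - 0) by ring.
  apply (clim_Cmod_le eventually (csum (second_difference y k))).
  - apply has_sum_lhs_coef.
  - apply filter_forall. intros L.
    replace (csum (second_difference y k) L - 0)
      with (csum (second_difference y k) L) by ring.
    apply csum_second_difference_bound, Hb.
Qed.

(** * Locally uniform majorants and convergence of the series *)

Lemma kernel_bound_of_lower_bound (y : C) (c : R) :
  (0 < c)%R ->
  (forall n : nat, (1 <= n)%nat -> (c * INR n ^ 2 <= Cmod (INR n ^ 2 + y ^ 2))%R) ->
  kernel_bound y (/ c).
Proof.
  intros Hc Hb. split; [left; apply Rinv_0_lt_compat, Hc|].
  intros j Hj. pose proof (INR_ge_1 j Hj) as Hj1. specialize (Hb j Hj).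
  assert (0 < c * INR j ^ 2)%R by (apply Rmult_lt_0_compat; [lra | apply pow_lt; lra]).
  unfold odd_kernel. rewrite Cmod_div by (apply Cmod_gt_0; lra). rewrite Cmod_INR.
  apply Rle_div_l; [lra|].
  replace (INR j) with (/ c / INR j * (c * INR j ^ 2))%R at 1 by (field; lra).
  apply Rmult_le_compat_l; [|exact Hb].
  apply Rdiv_le_0_compat; [left; apply Rinv_0_lt_compat, Hc | lra].
Qed.

Lemma quotient_bound (a w : C) (A c : R) (k : nat) :
  (1 <= k)%nat -> (0 < c)%R ->
  (Cmod a <= A * harmonic k)%R -> (c * INR k ^ 2 <= Cmod w)%R ->
  (Cmod (a / w) <= A / c * (harmonic k / INR k ^ 2))%R.
Proof.
  intros Hk Hc Ha Hw. pose proof (INR_ge_1 k Hk) as Hk1.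
  assert (0 < c * INR k ^ 2)%R by (apply Rmult_lt_0_compat; [lra | apply pow_lt; lra]).
  rewrite Cmod_div by (apply Cmod_gt_0; lra).
  replace (A / c * (harmonic k / INR k ^ 2))%R
    with (A * harmonic k / (c * INR k ^ 2))%R by (field; lra).
  apply Rmult_le_compat; [apply Cmod_ge_0 | | exact Ha |].
  - left. apply Rinv_0_lt_compat. lra.
  - apply Rinv_le_contravar; lra.
Qed.

(** One majorant serves two passages to the limit: in [L] at a fixed point, and in the point itself.
    Closeness is measured on the squares, through which alone [x] and [y] enter. *)
Lemma lhs_term_bound (x y : C) :
  nonvanishing x -> nonvanishing y ->
  exists d K : R, (0 < d)%R /\
    forall x' y' : C, (Cmod (x' ^ 2 - x ^ 2) < d)%R -> (Cmod (y' ^ 2 - y ^ 2) < d)%R ->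
    forall n : nat, (1 <= n)%nat ->
      (Cmod (lhs_term x' y' n) <= K * (harmonic n / INR n ^ 2))%R
      /\ forall L : nat,
      (Cmod (- csum (second_difference y' n) L / (INR n ^ 2 + x' ^ 2))
        <= K * (harmonic n / INR n ^ 2))%R.
Proof.
  intros Hx Hy.
  destruct (sqr_plus_lower_bound (x ^ 2) Hx) as [c [d [Hc [Hd Hb]]]].
  destruct (sqr_plus_lower_bound (y ^ 2) Hy) as [c' [d' [Hc' [Hd' Hb']]]].
  exists (Rmin d d'), (6 * / c' / c)%R. split; [apply Rmin_pos; assumption|].
  intros x' y' Hx' Hy' n Hn.
  pose proof (Rmin_l d d') as Hl. pose proof (Rmin_r d d') as Hr.
  assert (Hlow : (c * INR n ^ 2 <= Cmod (INR n ^ 2 + x' ^ 2))%R)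
    by (apply Hb; [lra | exact Hn]).
  assert (Hker : kernel_bound y' (/ c')).
  { apply kernel_bound_of_lower_bound; [exact Hc'|].
    intros m Hm. apply Hb'; [lra | exact Hm]. }
  split; [rewrite lhs_term_coef by exact Hn | intros L];
    apply quotient_bound; try assumption.
  - apply lhs_coef_bound, Hker.
  - rewrite Cmod_opp. apply csum_second_difference_bound, Hker.
Qed.

Lemma has_sum_lhs (x y : C) :
  admissible x y -> has_sum (lhs_term x y) (lhs x y).
Proof.
  intros [Hx Hy].
  destruct (lhs_term_bound x y) as [d [K [Hd Hb]]];
    [apply not_negative_integer_nonvanishing; assumption ..|].
  assert (H0 : forall z : C, (Cmod (z - z) < d)%R).
  { intros z. replace (z - z) with (RtoC 0) by ring. rewrite Cmod_0. exact Hd. }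
  destruct (ex_has_sum (lhs_term x y) (fun n => K * (harmonic n / INR n ^ 2))%R)
    as [l Hl].
  - apply summable_scal, summable_harmonic.
  - intros n Hn. apply Hb; auto.
  - unfold lhs. destruct (Cseries1_has_sum _ _ Hl) as [_ ->]. exact Hl.
Qed.

(** The denominator expands to [n ^ 4 + 2 (x ^ 2 + y ^ 2) n ^ 2 + (y ^ 2 - x ^ 2) ^ 2]; the quartic
    term wins for large [n], and finitely many nonzero values remain. *)
Lemma den_lower_bound (x y : C) :
  den_nonzero x y ->
  exists c : R, (0 < c)%R /\
    forall n : nat, (1 <= n)%nat -> (c * INR n ^ 4 <= Cmod (den x y n))%R.
Proof.
  intros Hden.
  set (A := Cmod (2 * (x ^ 2 + y ^ 2))). set (B := Cmod ((y ^ 2 - x ^ 2) ^ 2)).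
  pose proof (Cmod_ge_0 (2 * (x ^ 2 + y ^ 2))) as HA. fold A in HA.
  pose proof (Cmod_ge_0 ((y ^ 2 - x ^ 2) ^ 2)) as HB. fold B in HB.
  destruct (INR_unbounded (2 * (A + B) + 1)) as [N HN].
  assert (HN1 : (1 < INR N)%R) by lra.
  destruct (finite_lower_bound (fun n => Cmod (den x y n)) N) as [d [Hd Hb]].
  { intros n Hn. apply Cmod_gt_0, Hden, Hn. }
  assert (HN4 : (0 < INR N ^ 4)%R) by (apply pow_lt; lra).
  exists (Rmin (1 / 2) (d / INR N ^ 4)).
  split; [apply Rmin_pos; [lra | apply Rdiv_lt_0_compat; lra]|].
  intros n Hn. pose proof (INR_ge_1 n Hn) as Hn1.
  destruct (Nat.le_gt_cases n N) as [H|H].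
  - apply Rle_trans with (d / INR N ^ 4 * INR N ^ 4)%R.
    + apply Rmult_le_compat; [ | apply pow_le; lra | apply Rmin_r |].
      * apply Rmin_glb; [lra|]. apply Rdiv_le_0_compat; lra.
      * apply pow_incr. apply le_INR in H. lra.
    + replace (d / INR N ^ 4 * INR N ^ 4)%R with d by (field; lra).
      apply Hb. lia.
  - apply lt_INR in H.
    replace (den x y n) with (RtoC (INR n ^ 4)
      + ((2 * (x ^ 2 + y ^ 2)) * RtoC (INR n ^ 2) + (y ^ 2 - x ^ 2) ^ 2))
      by (unfold den; rewrite !RtoC_pow; ring).
    eapply Rle_trans; [|apply Cmod_minus_ge].
    assert (H2 : (Cmod (2 * (x ^ 2 + y ^ 2) * RtoC (INR n ^ 2) + (y ^ 2 - x ^ 2) ^ 2)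
      <= A * INR n ^ 2 + B)%R).
    { eapply Rle_trans; [apply Cmod_triangle|].
      rewrite Cmod_mult, (Cmod_R (INR n ^ 2)), Rabs_pos_eq by (apply pow_le; lra).
      fold A B. lra. }
    rewrite Cmod_R, Rabs_pos_eq by (apply pow_le; lra).
    assert (H3 : (Rmin (1 / 2) (d / INR N ^ 4) * INR n ^ 4 <= 1 / 2 * INR n ^ 4)%R).
    { apply Rmult_le_compat_r; [apply pow_le; lra | apply Rmin_l]. }
    assert (H4 : (INR n ^ 4 = INR n ^ 2 * INR n ^ 2)%R) by ring.
    assert (H5 : (1 <= INR n ^ 2)%R) by nra.
    assert (H6 : (2 * (A + B) <= INR n ^ 2)%R) by nra.
    rewrite H4 in *. set (q := (INR n ^ 2)%R) in *. nra.
Qed.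

Lemma rhs_terms_summable (x y : C) :
  admissible x y -> den_nonzero x y ->
  (exists l, has_sum (rhs_term1 x y) l) /\ (exists l, has_sum (rhs_term2 x y) l).
Proof.
  intros [_ Hy] Hden.
  destruct (den_lower_bound x y Hden) as [c [Hc Hb]].
  destruct (sqr_plus_lower_bound (y ^ 2)
    (not_negative_integer_nonvanishing y Hy)) as [c' [d [Hc' [Hd Hb']]]].
  assert (Hq : forall n : nat, (1 <= n)%nat ->
    (1 <= INR n)%R /\ (0 < c * INR n ^ 4)%R /\ (0 < c' * INR n ^ 2)%R).
  { intros n Hn. pose proof (INR_ge_1 n Hn).
    repeat split; [lra | |]; apply Rmult_lt_0_compat; try lra; apply pow_lt; lra. }
  assert (H2 : forall n : nat, (1 <= n)%nat ->
    (Cmod (rhs_term2 x y n) <= / c / INR n ^ 2)%R).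
  { intros n Hn. destruct (Hq n Hn) as [H1 [H2 _]]. specialize (Hb n Hn).
    unfold rhs_term2. rewrite Cmod_div by (apply Hden, Hn). rewrite Cmod_INR.
    apply Rle_div_l; [lra|].
    apply Rle_trans with (/ c / INR n ^ 2 * (c * INR n ^ 4))%R.
    - replace (/ c / INR n ^ 2 * (c * INR n ^ 4))%R with (INR n ^ 2)%R by (field; lra).
      nra.
    - apply Rmult_le_compat_l; [|exact Hb].
      apply Rdiv_le_0_compat; [left; apply Rinv_0_lt_compat, Hc | apply pow_lt; lra]. }
  split; [apply (ex_has_sum_inv_sqr _ (/ c' * / c)%R)
    | apply (ex_has_sum_inv_sqr _ (/ c)%R); exact H2].
  intros n Hn. destruct (Hq n Hn) as [H1 [H3 H4]]. specialize (H2 n Hn).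
  assert (H5 : (c' * INR n ^ 2 <= Cmod (INR n ^ 2 + y ^ 2))%R).
  { apply Hb'; [|exact Hn]. replace (y ^ 2 - y ^ 2) with (RtoC 0) by ring.
    rewrite Cmod_0. exact Hd. }
  assert (H6 : INR n ^ 2 + y ^ 2 <> 0) by (apply Cmod_gt_0; lra).
  replace (rhs_term1 x y n) with (/ (INR n ^ 2 + y ^ 2) * rhs_term2 x y n).
  2:{ unfold rhs_term1, rhs_term2. field. split; [apply Hden, Hn | exact H6]. }
  rewrite Cmod_mult, Cmod_inv by exact H6.
  unfold Rdiv. rewrite Rmult_assoc.
  apply Rmult_le_compat; [left; apply Rinv_0_lt_compat; lra | apply Cmod_ge_0 | | exact H2].
  apply Rinv_le_contravar; [exact Hc'|].
  assert (1 <= INR n ^ 2)%R by nra. nra.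
Qed.

(** The partial sums of [u] are shown to converge to both sides: to the left one by interchanging
    the sums over [n] and [k], to the right one by splitting [rhs_term]. *)
Lemma lhs_eq_rhs (x y : C) :
  admissible x y -> den_nonzero x y -> lhs x y = rhs x y.
Proof.
  intros Hadm Hden. pose proof Hadm as [Hx Hy].
  pose proof eventually_filter as FFp.
  assert (FF : Filter eventually) by apply FFp.
  pose proof (not_negative_integer_nonvanishing x Hx) as Hx'.
  pose proof (not_negative_integer_nonvanishing y Hy) as Hy'.
  destruct (rhs_terms_summable x y Hadm Hden) as [[l1 Hl1] [l2 Hl2]].
  unfold rhs. destruct (Cseries1_has_sum _ _ Hl1) as [_ ->].
  destruct (Cseries1_has_sum _ _ Hl2) as [_ ->].
  set (u := fun n => pi_coth x * rhs_term x y n + 2 * pi_coth y * rhs_term2 x y n).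
  apply (clim_unique eventually (csum u)).
  - destruct (lhs_term_bound x y Hx' Hy') as [d [K [Hd Hb]]].
    assert (H0 : forall z : C, (Cmod (z - z) < d)%R).
    { intros z. replace (z - z) with (RtoC 0) by ring. rewrite Cmod_0. exact Hd. }
    (* The [L]-th partial sum of [u] is a series in [k] whose terms are sums over [n <= L]; as [L]
       grows they tend to the left-hand terms. *)
    apply (tannery eventually
      (fun L k => - csum (second_difference y k) L / (INR k ^ 2 + x ^ 2))
      (lhs_term x y) (fun k => K * (harmonic k / INR k ^ 2))%R 0).
    + apply summable_scal, summable_harmonic.
    + apply filter_forall. intros L k Hk. apply Hb; auto.
    + intros k Hk. rewrite lhs_term_coef by exact Hk.
      apply clim_div; [exact FF | apply Hx', Hk | | apply clim_const, FF].
      apply (eq_ind (- - lhs_coef y k) (clim eventually _)); [|ring].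
      apply clim_opp; [exact FF | apply has_sum_lhs_coef].
    + apply filter_forall. intros L.
      apply (has_sum_ext
        (fun k => csum (fun n => - second_difference y k n / (INR k ^ 2 + x ^ 2)) L)).
      * intros k Hk.
        rewrite (csum_ext _ (fun n => (- (1) / (INR k ^ 2 + x ^ 2))
          * second_difference y k n)).
        -- rewrite csum_scal. unfold Cdiv. ring.
        -- intros n _. unfold Cdiv. ring.
      * apply (has_sum_csum
          (fun n k => - second_difference y k n / (INR k ^ 2 + x ^ 2)) u L).
        intros n Hn. apply has_sum_second_difference; auto.
    + apply has_sum_lhs, Hadm.
  (* Writing [n ^ 2 + x ^ 2 - 3 y ^ 2] as [(n ^ 2 + y ^ 2) + (x ^ 2 - 4 y ^ 2)] splits [rhs_term]
     into [rhs_term2] and a multiple of [rhs_term1]. *)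
  - apply (eq_ind ((pi_coth x * (x ^ 2 - 4 * y ^ 2)) * l1
      + (2 * pi_coth y + pi_coth x) * l2) (has_sum u)); [|ring].
    generalize (has_sum_plus _ _ _ _
      (has_sum_scal (pi_coth x * (x ^ 2 - 4 * y ^ 2)) _ _ Hl1)
      (has_sum_scal (2 * pi_coth y + pi_coth x) _ _ Hl2)).
    apply has_sum_ext. intros n Hn.
    unfold u, rhs_term, rhs_term1, rhs_term2. field.
    split; [apply Hden, Hn | apply Hy', Hn].
Qed.

(** * Generic points and the limit *)

(** Every exceptional condition forces one of [x], [y], [x + y], [x - y] onto the imaginary axis, so
    four real inequalities exclude them all. *)
Lemma generic_of_real_parts (x y : C) :
  Re x <> 0%R -> Re y <> 0%R -> Re (x + y) <> 0%R -> Re (x - y) <> 0%R ->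
  generic (x, y).
Proof.
  assert (Hnz : forall z : C, Re z <> 0%R -> z <> 0).
  { intros z Hz E. apply Hz. rewrite E. reflexivity. }
  assert (Hneg : forall z : C, Re z <> 0%R -> ~ negative_integer (z ^ 2)).
  { intros z Hz [k [Hk E]]. apply IZR_lt in Hk.
    destruct z as [a b]. simpl in Hz. injection E as E1 E2. simpl in E1, E2.
    (* A real square with nonzero real part [a] forces the imaginary part to be 0, and then the
       square is positive. *)
    assert (Hb : b = 0%R) by nra. subst b. nra. }
  intros Hx Hy Hp Hm. unfold generic; simpl fst; simpl snd.
  split; [split; apply Hneg; assumption|].
  split; [apply Hnz, Hx|]. split; [apply Hnz, Hy|].
  intros n Hn E.
  assert (Hshift : forall (s : R) (z : C), Re z <> 0%R -> RtoC s + Ci * z <> 0).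
  { intros s [a b] Hz E'. apply Hz. injection E' as _ E'. simpl in E' |- *. lra. }
  revert E.
  (* The denominator is a product of four linear factors; the imaginary part of each is the real
     part of [x + y] or [x - y]. *)
  replace (den x y n) with
    ((INR n + Ci * (x + y)) * (INR n + Ci * (x - y))
      * ((RtoC (- INR n) + Ci * (x + y)) * (RtoC (- INR n) + Ci * (x - y)))).
  - repeat apply Cmult_neq_0; apply Hshift; assumption.
  - assert (Ei : Ci * Ci = - (1)) by (unfold Ci; apply injective_projections; simpl; ring).
    unfold den. rewrite RtoC_opp. set (N := RtoC (INR n)).
    replace ((N + Ci * (x + y)) * (N + Ci * (x - y)) *
      ((- N + Ci * (x + y)) * (- N + Ci * (x - y))))
      with (((Ci * Ci) * (x + y) ^ 2 - N ^ 2) * ((Ci * Ci) * (x - y) ^ 2 - N ^ 2)) by ring.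
    rewrite Ei. ring.
Qed.

Lemma avoid_finite (l : list R) (e : R) :
  (0 < e)%R -> exists t, (0 < t < e)%R /\ ~ In t l.
Proof.
  intros He.
  assert (H : exists d, (0 < d <= e)%R /\ forall t, (0 < t < d)%R -> ~ In t l).
  { induction l as [|a l [d [Hd IH]]].
    - exists e. split; [lra|]. intros t _ [].
    - destruct (Rlt_dec 0 a) as [Ha|Ha].
      + exists (Rmin d a). pose proof (Rmin_l d a). pose proof (Rmin_r d a).
        split; [split; [apply Rmin_pos; lra | lra]|].
        intros t Ht [<-|Hin]; [lra|]. revert Hin. apply IH. lra.
      + exists d. split; [exact Hd|].
        intros t Ht [<-|Hin]; [lra|]. revert Hin. apply IH. lra. }
  destruct H as [d [Hd H]]. exists (d / 2)%R. split; [lra|]. apply H. lra.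
Qed.

Lemma generic_dense (x y : C) (e : R) :
  (0 < e)%R ->
  exists s t : R, (Rabs s < e)%R /\ (Rabs t < e)%R /\ generic (x + s, y + t).
Proof.
  intros He.
  assert (Hs : exists s, (Rabs s < e)%R /\ (Re x + s <> 0)%R).
  { destruct (Req_dec_T (Re x + e / 2) 0) as [E|E].
    - exists 0%R. rewrite Rabs_R0. split; lra.
    - exists (e / 2)%R. rewrite Rabs_pos_eq by lra. split; lra. }
  destruct Hs as [s [Hs1 Hs2]]. set (r := (Re x + s)%R) in *.
  assert (Ht : exists t, (Rabs t < e)%R /\ (Re y + t <> 0)%R
    /\ (r + (Re y + t) <> 0)%R /\ (r - (Re y + t) <> 0)%R).
  (* The three excluded shifts are those making the real part of the new [y], of the sum, or of the
     difference vanish. *)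
  { destruct (avoid_finite (- Re y :: - r - Re y :: r - Re y :: nil)%R e He) as [t [Ht Hav]].
    exists t. rewrite Rabs_pos_eq by lra. simpl in Hav.
    split; [lra|]. split; [|split]; intros E; apply Hav; lra. }
  destruct Ht as [t [Ht1 [Ht2 [Ht3 Ht4]]]].
  exists s, t. split; [exact Hs1|]. split; [exact Ht1|].
  unfold r in *.
  apply generic_of_real_parts; destruct x as [a b], y as [a' b']; simpl in *; lra.
Qed.

Lemma ball_Cmod (z w : C) (eps : R) :
  (Cmod (w - z) < eps)%R -> ball (M := C_UniformSpace) z eps w.
Proof. apply C_NormedModule_mixin_compat1. Qed.

Lemma clim_fst (x y : C) :
  clim (locally (T := prod_UniformSpace C_UniformSpace C_UniformSpace) (x, y))
    (fun p => fst p) x.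
Proof.
  apply filterlim_clim; [apply locally_filter|].
  intros P [d Hd]. exists d. intros p [Hp _]. apply Hd, Hp.
Qed.

Lemma clim_snd (x y : C) :
  clim (locally (T := prod_UniformSpace C_UniformSpace C_UniformSpace) (x, y))
    (fun p => snd p) y.
Proof.
  apply filterlim_clim; [apply locally_filter|].
  intros P [d Hd]. exists d. intros p [_ Hp]. apply Hd, Hp.
Qed.

Lemma clim_within {T : Type} (D : T -> Prop) (F : (T -> Prop) -> Prop) {FF : Filter F}
    (f : T -> C) (l : C) :
  clim F f l -> clim (within D F) f l.
Proof.
  intros Hf eps He. generalize (Hf eps He). unfold within. apply filter_imp.
  intros t Ht _. exact Ht.
Qed.

Lemma clim_pow {T : Type} (F : (T -> Prop) -> Prop) {FF : Filter F}
    (f : T -> C) (l : C) (n : nat) :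
  clim F f l -> clim F (fun t => f t ^ n) (l ^ n).
Proof.
  intros Hf. induction n as [|n IH]; simpl; [apply clim_const, FF|].
  apply clim_mult; [exact FF | exact Hf | exact IH].
Qed.

Lemma clim_lhs_term {T : Type} (F : (T -> Prop) -> Prop) {FF : Filter F}
    (f g : T -> C) (x y : C) (n : nat) :
  nonvanishing x -> nonvanishing y -> (1 <= n)%nat ->
  clim F f x -> clim F g y ->
  clim F (fun t => lhs_term (f t) (g t) n) (lhs_term x y n).
Proof.
  intros Hx Hy Hn Hf Hg.
  assert (Hsqr : forall (h : T -> C) (z : C) (k : nat), clim F h z ->
    clim F (fun t => INR k ^ 2 + h t ^ 2) (INR k ^ 2 + z ^ 2)).
  { intros h z k Hh. apply clim_plus; [exact FF | apply clim_const, FF |].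
    apply clim_pow; assumption. }
  assert (Hker : forall k, (1 <= k)%nat ->
    clim F (fun t => odd_kernel (g t) (INR k)) (odd_kernel y (INR k))).
  { intros k Hk. apply clim_div; [exact FF | apply Hy, Hk | apply clim_const, FF |].
    apply Hsqr, Hg. }
  rewrite lhs_term_coef by exact Hn.
  apply clim_ext with (fun t => lhs_coef (g t) n / (INR n ^ 2 + f t ^ 2)); [exact FF| |].
  - apply filter_forall. intros t. symmetry. apply lhs_term_coef, Hn.
  - apply clim_div; [exact FF | apply Hx, Hn | | apply Hsqr, Hf].
    apply clim_minus; [exact FF | | apply Hker, Hn].
    clear Hn. induction n as [|n IH]; [exact (clim_const F 0)|].
    apply (clim_plus F (fun t => csum (fun m => 2 * odd_kernel (g t) (INR m)) n)
      (fun t => 2 * odd_kernel (g t) (INR (S n)))); [exact IH|].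
    apply clim_mult; [exact FF | apply clim_const, FF | apply Hker; lia].
Qed.

Lemma within_generic_proper (x y : C) :
  ProperFilter (within generic
    (locally (T := prod_UniformSpace C_UniformSpace C_UniformSpace) (x, y))).
Proof.
  constructor; [|apply within_filter, locally_filter].
  intros P [d Hd].
  destruct (generic_dense x y d (cond_pos d)) as [s [t [Hs [Ht Hg]]]].
  exists (x + s, y + t). apply Hd; [|exact Hg].
  split; apply ball_Cmod; simpl.
  - replace (x + s - x) with (RtoC s) by ring. rewrite Cmod_R. exact Hs.
  - replace (y + t - y) with (RtoC t) by ring. rewrite Cmod_R. exact Ht.
Qed.

Theorem theorem3 : forall x y : C,
  admissible x y ->
  ex_Cseries1 (lhs_term x y)
  /\ (den_nonzero x y ->
        ex_Cseries1 (rhs_term1 x y) /\ ex_Cseries1 (rhs_term2 x y)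
        /\ lhs x y = rhs x y)
  /\ is_limit_along generic (fun p => rhs (fst p) (snd p)) (x, y) (lhs x y).
Proof.
  intros x y Hadm. pose proof Hadm as [Hx Hy].
  apply not_negative_integer_nonvanishing in Hx, Hy.
  split; [apply (Cseries1_has_sum _ _ (has_sum_lhs x y Hadm))|].
  split.
  - intros Hden.
    destruct (rhs_terms_summable x y Hadm Hden) as [[l1 H1] [l2 H2]].
    split; [apply (Cseries1_has_sum _ _ H1)|].
    split; [apply (Cseries1_has_sum _ _ H2)|].
    apply lhs_eq_rhs; assumption.
  - unfold is_limit_along. pose proof (within_generic_proper x y) as HP.
    split; [exact HP|].
    assert (FF : Filter (within generic
      (locally (T := prod_UniformSpace C_UniformSpace C_UniformSpace) (x, y))))
      by apply HP.
    assert (Hgen : within generic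
      (locally (T := prod_UniformSpace C_UniformSpace C_UniformSpace) (x, y)) generic).
    { unfold within. apply filter_forall. intros p Hp. exact Hp. }
    pose proof (clim_within generic _ _ _ (clim_fst x y)) as Hfst.
    pose proof (clim_within generic _ _ _ (clim_snd x y)) as Hsnd.
    apply filterlim_clim; [exact FF|].
    (* At generic points the two sides agree, so the claim becomes continuity of the left-hand side
       at [(x, y)]. *)
    apply clim_ext with (fun p => lhs (fst p) (snd p)); [exact FF| |].
    { generalize Hgen. apply filter_imp. intros p [Hp [_ [_ Hden]]].
      apply lhs_eq_rhs; assumption. }
    destruct (lhs_term_bound x y Hx Hy) as [d [K [Hd Hb]]].
    (* Tannery's theorem again, now with the point as the moving parameter and the locally uniform
       majorant. *)
    apply (tannery _ (fun p => lhs_term (fst p) (snd p)) (lhs_term x y)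
      (fun n => K * (harmonic n / INR n ^ 2))%R 0).
    + apply summable_scal, summable_harmonic.
    + generalize (filter_and _ _ (clim_pow _ _ _ 2 Hfst d Hd) (clim_pow _ _ _ 2 Hsnd d Hd)).
      apply filter_imp. intros p [H1 H2] k Hk. apply Hb; assumption.
    + intros k Hk. apply clim_lhs_term; assumption.
    + generalize Hgen. apply filter_imp. intros p [Hp _]. apply has_sum_lhs, Hp.
    + apply has_sum_lhs, Hadm.
Qed.
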